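(* Let $A$ be an FDZ-scalar ring and let $M$ be a finitely generated $A$-module. Then there exists a sentence $\psi_{M,A}$ of the language $L_2$ such that $\langle M,A\rangle\models\psi_{M,A}$ and, for any FDZ-scalar ring $B$ and any finitely generated $B$-module $N$, $$\langle N,B\rangle\models\psi_{M,A}\iff\langle N,B\rangle\cong\langle M,A\rangle,$$ where $\cong$ is isomorphism of two-sorted modules.
   Context: A scalar ring is a commutative associative ring with unit. An FDZ-scalar ring is a scalar ring whose additive group is finitely generated as an abelian group. An $A$-module $M$ over a scalar ring $A$ is regarded as a two-sorted structure $\langle M,A\rangle=\langle M,A,s\rangle$, where $M$ is an abelian group, $A$ is a scalar ring (in the language of rings with identity) and $s(x,y,z)$ ($x,z$ of sort $M$, $y$ of sort $A$) is the predicate describing the action: $s(m,a,n)$ holds iff $a\cdot m=n$. $L_2$ is the first-order language of these two-sorted structures. An isomorphism of two-sorted modules $\langle M,A,s\rangle\to\langle N,B,t\rangle$ is a pair $(\theta_1,\theta_2)$ with $\theta_1:M\to N$ an isomorphism of abelian groups and $\theta_2:A\to B$ an isomorphism of rings such that $s(m_1,a,m_2)\Leftrightarrow t(\theta_1(m_1),\theta_2(a),\theta_1(m_2))$ for all $a\in A$, $m_1,m_2\in M$. *)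

(* Defs.v *)
From HB Require Import structures.
From mathcomp Require Import all_boot all_order all_algebra.
Set Implicit Arguments.
Unset Strict Implicit.
Unset Printing Implicit Defensive.
Import GRing.Theory.
Local Open Scope ring_scope.

(* Scalar rings are comPzRingType: the trivial ring (0 = 1) is allowed.
   The [inIntSpan] of MathComp's rat.v is the predicate of being an integral
   linear combination of a given tuple. *)
Definition fg_abelian (V : zmodType) : Prop :=
  exists (n : nat) (e : n.-tuple V), forall v : V, inIntSpan e v.

Definition FDZ_scalar_ring (A : comPzRingType) : Prop := fg_abelian A.

Definition fg_module (A : comPzRingType) (M : lmodType A) : Prop :=
  exists (n : nat) (e : n.-tuple M), forall v : M,
    exists c : A ^ n, v = \sum_(i < n) c i *: e`_i.

(* The predicate s(x, y, z) of the two-sorted structure <M, A>. *)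
Definition act_pred (A : comPzRingType) (M : lmodType A)
    (m : M) (a : A) (n : M) : Prop := a *: m = n.

(* Syntax of L_2. Each sort has its own variables, named by natural numbers. *)
Inductive mterm : Type :=
  | MVar of nat
  | MZero
  | MOpp of mterm
  | MAdd of mterm & mterm.

Inductive aterm : Type :=
  | AVar of nat
  | AZero
  | AOne
  | AOpp of aterm
  | AAdd of aterm & aterm
  | AMul of aterm & aterm.

Inductive formula : Type :=
  | FEqM of mterm & mterm
  | FEqA of aterm & aterm
  | FAct of mterm & aterm & mterm
  | FNot of formula
  | FAnd of formula & formula
  | FOr of formula & formula
  | FImp of formula & formula
  | FAllM of nat & formula
  | FExM of nat & formula
  | FAllA of nat & formula
  | FExA of nat & formula.

Fixpoint mterm_vars (t : mterm) : seq nat :=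
  match t with
  | MVar i => [:: i]
  | MZero => [::]
  | MOpp t1 => mterm_vars t1
  | MAdd t1 t2 => mterm_vars t1 ++ mterm_vars t2
  end.

Fixpoint aterm_vars (t : aterm) : seq nat :=
  match t with
  | AVar i => [:: i]
  | AZero | AOne => [::]
  | AOpp t1 => aterm_vars t1
  | AAdd t1 t2 | AMul t1 t2 => aterm_vars t1 ++ aterm_vars t2
  end.

Fixpoint free_mvars (f : formula) : seq nat :=
  match f with
  | FEqM t u => mterm_vars t ++ mterm_vars u
  | FEqA _ _ => [::]
  | FAct t _ u => mterm_vars t ++ mterm_vars u
  | FNot g => free_mvars g
  | FAnd g h | FOr g h | FImp g h => free_mvars g ++ free_mvars h
  | FAllM i g | FExM i g => [seq j <- free_mvars g | j != i]
  | FAllA _ g | FExA _ g => free_mvars g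
  end.

Fixpoint free_avars (f : formula) : seq nat :=
  match f with
  | FEqM _ _ => [::]
  | FEqA t u => aterm_vars t ++ aterm_vars u
  | FAct _ t _ => aterm_vars t
  | FNot g => free_avars g
  | FAnd g h | FOr g h | FImp g h => free_avars g ++ free_avars h
  | FAllM _ g | FExM _ g => free_avars g
  | FAllA i g | FExA i g => [seq j <- free_avars g | j != i]
  end.

Definition is_sentence (f : formula) : Prop :=
  free_mvars f = [::] /\ free_avars f = [::].

Definition upd (T : Type) (v : nat -> T) (i : nat) (x : T) : nat -> T :=
  fun j => if j == i then x else v j.

Fixpoint meval (V : zmodType) (v : nat -> V) (t : mterm) : V :=
  match t with
  | MVar i => v i
  | MZero => 0
  | MOpp t1 => - meval v t1
  | MAdd t1 t2 => meval v t1 + meval v t2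
  end.

Fixpoint aeval (A : comPzRingType) (w : nat -> A) (t : aterm) : A :=
  match t with
  | AVar i => w i
  | AZero => 0
  | AOne => 1
  | AOpp t1 => - aeval w t1
  | AAdd t1 t2 => aeval w t1 + aeval w t2
  | AMul t1 t2 => aeval w t1 * aeval w t2
  end.

Fixpoint holds (A : comPzRingType) (M : lmodType A)
    (v : nat -> M) (w : nat -> A) (f : formula) : Prop :=
  match f with
  | FEqM t u => meval v t = meval v u
  | FEqA t u => aeval w t = aeval w u
  | FAct t a u => act_pred (meval v t) (aeval w a) (meval v u)
  | FNot g => ~ holds v w g
  | FAnd g h => holds v w g /\ holds v w h
  | FOr g h => holds v w g \/ holds v w h
  | FImp g h => holds v w g -> holds v w h
  | FAllM i g => forall x : M, holds (upd v i x) w g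
  | FExM i g => exists x : M, holds (upd v i x) w g
  | FAllA i g => forall a : A, holds v (upd w i a) g
  | FExA i g => exists a : A, holds v (upd w i a) g
  end.

(* For a sentence the assignments are irrelevant (both sorts are inhabited). *)
Definition models (A : comPzRingType) (M : lmodType A) (f : formula) : Prop :=
  forall (v : nat -> M) (w : nat -> A), holds v w f.

Definition module_iso (A : comPzRingType) (M : lmodType A)
    (B : comPzRingType) (N : lmodType B) : Prop :=
  exists (th1 : {additive M -> N}) (th2 : {rmorphism A -> B}),
    [/\ bijective th1, bijective th2
      & forall (m1 : M) (a : A) (m2 : M),
          act_pred m1 a m2 <-> act_pred (th1 m1) (th2 a) (th1 m2)].

(* Main.v *)
From HB Require Import structures.
Require Import Defs.
From mathcomp Require Import all_boot all_order all_algebra.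
From mathcomp Require Import generic_quotient boolp.

(** Let L be the A-module M * A.  Its additive group is finitely generated, so
L is Noetherian and has a prime filtration: a list s of elements of L that
spans L and in which every m generates, modulo the span of the elements r
that come after it, a copy of A / P for a prime ideal P.  Fix moreover additive
generators e of A and g of M.

The sentence says that there are tuples e' and g' which satisfy the finitely
many relations of e and g (additive relations, multiplication table, unit,
action).  This gives a ring morphism f from A to B and an f-semilinear phi from
M to N.  The sentence also says that the images of the entries of s span N * B,
so by the argument of the five lemma along the filtration (chain_bijectiveP)
f and phi are bijective as soon as f induces, for every entry of s, a bijection
from A / P to B / P', where P' is the annihilator in B of the image of m modulo
the image of r.  The ideal P' is definable.  The main point is thus
prime_detectable: bijectivity of A / P -> B / P' can be forced by a first-order
condition on P' and e', given that the additive group of B is finitely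
generated.

If A / P is finite, list its elements.  Otherwise O = A / P is a domain of
characteristic zero with a Z-basis u, and D = B / P' should be equal to O.
Requiring that D is a domain in which 2 is neither zero nor a unit makes D
torsion-free; requiring that every element of D is a combination of u with
coefficients 0, 1 plus an even element makes the index of O in D finite (it is
odd).  Since D has finite index over O, traces of elements of D are integers,
so d D is contained in O where d is the discriminant of the trace form of O.
This d depends on O alone (overring_denominator).  Hence D = O follows from
finitely many statements: no nonzero combination of u with coefficients in
0, ..., d - 1 is divisible by d in D.

The formulas are built as functions of the index of the first fresh variable;
the predicate fden says that such a function has a given meaning in every
environment extending a given one, and quantifiers are handled by passing to
such an extension. *)

Set Implicit Arguments.
Unset Strict Implicit.
Unset Printing Implicit Defensive.
Import GRing.Theory Num.Theory.
Local Open Scope ring_scope.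

(** * Integral combinations and bases *)

(** The coefficients form a row vector so that integer matrices act on them: see
[comb_mulmx]. *)
Definition comb (V : zmodType) n (e : 'I_n -> V) (k : 'rV[int]_n) : V :=
  \sum_i e i *~ k 0 i.

Definition generates (V : zmodType) n (e : 'I_n -> V) : Prop :=
  forall x, exists k, x = comb e k.

Section Comb.
Variables (V : zmodType) (n : nat).
Implicit Types (e : 'I_n -> V) (k : 'rV[int]_n).

Lemma comb0 e : comb e 0 = 0.
Proof. by rewrite /comb big1 // => i _; rewrite mxE mulr0z. Qed.

Lemma combD e k l : comb e (k + l) = comb e k + comb e l.
Proof. by rewrite /comb -big_split; apply: eq_bigr => i _; rewrite mxE mulrzDr. Qed.

Lemma combN e k : comb e (- k) = - comb e k.
Proof. by rewrite /comb -sumrN; apply: eq_bigr => i _; rewrite mxE mulrNz. Qed.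

Lemma combB e k l : comb e (k - l) = comb e k - comb e l.
Proof. by rewrite combD combN. Qed.

Lemma combZ e k (z : int) : comb e (z *: k) = comb e k *~ z.
Proof.
by rewrite /comb mulrz_suml; apply: eq_bigr => i _; rewrite mxE -mulrzA mulrC.
Qed.

Lemma comb_delta e i : comb e (delta_mx 0 i) = e i.
Proof.
rewrite /comb (bigD1 i) //= big1 ?addr0; first by rewrite mxE !eqxx.
by move=> j /negPf ji; rewrite mxE ji andbF mulr0z.
Qed.

Lemma comb_mulmx m e (k : 'rV[int]_m) (C : 'M_(m, n)) :
  comb e (k *m C) = comb (fun i => comb e (row i C)) k.
Proof.
rewrite /comb; under [RHS]eq_bigr => i _ do rewrite mulrz_suml.
rewrite exchange_big; apply: eq_bigr => j _; rewrite mxE mulrz_sumr.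
by apply: eq_bigr => i _; rewrite mxE -mulrzA mulrC.
Qed.

Lemma raddf_comb (W : zmodType) (f : {additive V -> W}) e k :
  f (comb e k) = comb (f \o e) k.
Proof. by rewrite raddf_sum; apply: eq_bigr => i _; rewrite raddfMz. Qed.

End Comb.

Definition coord (V : zmodType) n (e : 'I_n -> V) (gen : generates e) (x : V)
  : 'rV[int]_n := sval (cid (gen x)).

Lemma coordK (V : zmodType) n (e : 'I_n -> V) (gen : generates e) x :
  comb e (coord gen x) = x.
Proof. by rewrite /coord; case: cid. Qed.

Lemma eq_comb (V : zmodType) n (e e' : 'I_n -> V) : e =1 e' -> comb e =1 comb e'.
Proof. by move=> ee' k; apply: eq_bigr => i _; rewrite ee'. Qed.

Lemma fg_abelianP (V : zmodType) :
  fg_abelian V <-> exists n (e : 'I_n -> V), generates e.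
Proof.
split=> [[n [e he]]|[n [e he]]]; exists n.
  exists (fun i => e`_i) => x; have [c ->] := he x.
  by exists (\row_i c i); apply: eq_bigr => i _; rewrite mxE.
exists [tuple e i | i < n] => x; have [k ->] := he x.
exists [ffun i => k 0 i]; apply: eq_bigr => i _.
by rewrite ffunE -tnth_nth tnth_mktuple.
Qed.

Definition torsion_free (V : zmodType) : Prop :=
  forall (x : V) (k : int), x *~ k = 0 -> k = 0 \/ x = 0.

Definition independent (V : zmodType) n (e : 'I_n -> V) : Prop :=
  forall k, comb e k = 0 -> k = 0.

Lemma comb_inj (V : zmodType) n (e : 'I_n -> V) :
  independent e -> injective (comb e).
Proof.
move=> ind k l /eqP.
rewrite -subr_eq0 -combB => /eqP/ind/eqP.
by rewrite subr_eq0 => /eqP.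
Qed.

(** By the Smith normal form, a nontrivial relation between generators says, for
suitable new generators, that a nonzero multiple of the first one is zero.  As the
group is torsion-free, that generator is zero and can be dropped. *)
Lemma exists_basis (V : zmodType) n (e : 'I_n -> V) :
    torsion_free V -> generates e ->
  exists m (b : 'I_m -> V), generates b /\ independent b.
Proof.
move=> tf; elim: n e => [|n IHn] e gen.
  by exists 0, e; split=> // k _; apply/rowP => -[].
have [ind|] := pselect (independent e); first by exists n.+1, e.
move=> /existsNP[k /not_implyP[ek /eqP k0]].
have [L Lu [R Ru [d _ kE]]] := int_Smith_normal_form k.
pose f i := comb e (row i R).
have fE l : comb f l = comb e (l *m R) by rewrite comb_mulmx.
have f0 : f 0 = 0.
  have kE' : k = (L 0 0 * d`_0) *: row 0 R.
    rewrite kE {1}[L]mx11_scalar mul_scalar_mx -scalemxAl -scalerA; congr (_ *: _).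
    apply/rowP => j; rewrite mxE (bigD1 0) //= big1 ?addr0 ?mxE //.
    by move=> i /negPf; rewrite -val_eqE /= => i0; rewrite !mxE eq_sym i0 mul0r.
  have := ek; rewrite kE' combZ => /tf[c0|//].
  by rewrite kE' c0 scale0r eqxx in k0.
apply: (IHn (fun i => f (lift ord0 i))) => x.
have [l ->] := gen x.
exists (\row_i (l *m invmx R) 0 (lift ord0 i)).
rewrite -[l in LHS](mulmxKV Ru) -fE /comb big_ord_recl f0 mul0rz add0r.
by apply: eq_bigr => i _; rewrite [in RHS]mxE.
Qed.

(** * Spans and the ascending chain condition *)

(** One generator is peeled off at a time: prime filtrations and the formula
[lf_span] follow the same recursion. *)
Fixpoint span (A : comPzRingType) (L : lmodType A) (s : seq L) (x : L) : Prop :=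
  if s is m :: r then exists a : A, span r (x - a *: m) else x = 0.

Section Span.
Variables (A : comPzRingType) (L : lmodType A).
Implicit Types (s : seq L) (x y : L).

Lemma span0 s : span s 0.
Proof. by elim: s => //= m s IHs; exists 0; rewrite scale0r subr0. Qed.

Lemma spanD s x y : span s x -> span s y -> span s (x + y).
Proof.
elim: s x y => [|m s IHs] x y /=; first by move=> -> ->; rewrite addr0.
move=> [a xa] [b yb]; exists (a + b).
by rewrite scalerDl opprD addrACA; apply: IHs.
Qed.

Lemma spanZ s a x : span s x -> span s (a *: x).
Proof.
elim: s x => [|m s IHs] x /=; first by move=> ->; rewrite scaler0.
by move=> [b xb]; exists (a * b); rewrite -scalerA -scalerBr; apply: IHs.
Qed.

Lemma spanN s x : span s x -> span s (- x).
Proof. by rewrite -scaleN1r; apply: spanZ. Qed.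

Lemma spanB s x y : span s x -> span s y -> span s (x - y).
Proof. by move=> sx sy; apply: spanD => //; apply: spanN. Qed.

Lemma span_cons m s x : span s x -> span (m :: s) x.
Proof. by exists 0; rewrite scale0r subr0. Qed.

Lemma mem_span s x : x \in s -> span s x.
Proof.
elim: s => //= m s IHs; rewrite inE => /orP[/eqP ->|/IHs].
  by exists 1; rewrite scale1r subrr; apply: span0.
exact: span_cons.
Qed.

Lemma span_min (H : L -> Prop) s :
    H 0 -> (forall a x y, H x -> H y -> H (a *: x + y)) ->
  {in s, forall x, H x} -> forall x, span s x -> H x.
Proof.
move=> H0 HD; elim: s => [|m s IHs] Hs x /=; first by move=> ->.
move=> [a xa]; rewrite -[x](subrK (a *: m)) addrC; apply: HD.
  by apply: Hs; rewrite mem_head.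
by apply: IHs xa => y ys; apply: Hs; rewrite inE ys orbT.
Qed.

End Span.

(** The subgroup generated by a list, as the span over the ring of integers. *)
Definition zspan (V : zmodType) (s : seq V) (x : V) : Prop :=
  span (s : seq (zmodule V)) x.

Definition subgroup (V : zmodType) (H : V -> Prop) : Prop :=
  H 0 /\ forall x y, H x -> H y -> H (x - y).

Section Subgroups.
Variable V : zmodType.
Implicit Types (s t : seq V) (x y : V) (H : V -> Prop).

Lemma subgroupN H x : subgroup H -> H x -> H (- x).
Proof. by move=> [H0 HB] Hx; rewrite -[- x]add0r; apply: HB. Qed.

Lemma subgroupD H x y : subgroup H -> H x -> H y -> H (x + y).
Proof.
move=> sH Hx Hy; rewrite -[y]opprK; apply: (proj2 sH) => //.
exact: subgroupN.
Qed.

Lemma subgroupMz H x (k : int) : subgroup H -> H x -> H (x *~ k).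
Proof.
move=> sH Hx; have Hn (n : nat) : H (x *+ n).
  by elim: n => [|n IHn]; [case: sH|rewrite mulrS; apply: subgroupD].
by case: k => n; [|apply: subgroupN]; rewrite -?pmulrn.
Qed.

Lemma zspan_subgroup s : subgroup (zspan s).
Proof. by split=> [|x y]; [apply: span0|apply: spanB]. Qed.

Lemma zspan_min H s : subgroup H -> {in s, forall x, H x} ->
  forall x, zspan s x -> H x.
Proof.
move=> sH; apply: (@span_min _ (zmodule V)); first by case: sH.
by move=> a x y Hx Hy; apply: subgroupD => //; apply: subgroupMz.
Qed.

Lemma generates_zspan n (e : 'I_n -> V) :
  generates e -> forall x, zspan (codom e) x.
Proof.
move=> gen x; have [k ->] := gen x.
apply: (big_ind (zspan (codom e))); first exact: span0.
  by move=> *; apply: spanD.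
move=> i _; apply: subgroupMz; first exact: zspan_subgroup.
by apply: mem_span; apply: codom_f.
Qed.

End Subgroups.

Lemma int_subgroup (I : int -> Prop) : subgroup I ->
  exists2 d, I d & forall k, I k -> (d %| k)%Z.
Proof.
move=> sI; have [[n n0 In]|no] := pselect (exists2 n : nat, (0 < n)%N & I n);
  last first.
  exists 0; first by case: sI.
  move=> k Ik; rewrite dvd0z; apply: contrapT => k0; apply: no.
  exists `|k|%N; first by rewrite absz_gt0; apply/negP.
  by case: (intP k) Ik => // m /(subgroupN sI); rewrite ?opprK ?abszN //.
have ex : exists n, (0 < n)%N && `[< I n%:Z >] by exists n; rewrite n0; apply/asboolP.
case: (ex_minnP ex) => m /andP[m0 /asboolP Im] minm.
exists m%:Z => // k Ik; apply/dvdz_mod0P; apply/eqP; rewrite -absz_eq0 -leqn0.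
have m0' : m%:Z != 0 by rewrite -absz_eq0 -lt0n.
have Ir : I (k %% m)%Z.
  have -> : (k %% m)%Z = k - m%:Z *~ (k %/ m)%Z by rewrite mulrzz mulrC /modz.
  by apply: (proj2 sI) => //; apply: subgroupMz.
have r0 := modz_ge0 k m0'; have := ltz_mod k m0'.
rewrite -(gez0_abs r0) /= ltz_nat => rm.
rewrite leqNgt; apply/negP => rpos; have := minm `|(k %% m)%Z|%N.
rewrite rpos gez0_abs //; move/(_ (asboolT Ir)); by rewrite leqNgt rm.
Qed.

Section Noetherian.
Variable V : zmodType.
Implicit Types (s t : seq V) (x y : V) (H : V -> Prop).

(** The coefficients at the first generator form an ideal of the integers;
a lift of its generator, added to generators of the intersection with the span
of the other generators, generates the subgroup. *)
Lemma subgroup_fg s H : subgroup H -> (forall x, H x -> zspan s x) ->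
  exists t, forall x, H x <-> zspan t x.
Proof.
elim: s H => [|y s IHs] H sH Hs.
  exists nil => x; split; first exact: Hs.
  by move=> /= ->; case: sH.
have [t tE] : exists t, forall x, H x /\ zspan s x <-> zspan t x.
  apply: (IHs (fun x => H x /\ zspan s x)) => [|x []//].
  split=> [|x z [Hx sx] [Hz sz]].
    by split; [case: sH|apply: span0].
  by split; [apply: (proj2 sH)|apply: spanB].
(* the ideal of the coefficients at y, and a lift h of its generator *)
have [d [h Hh hd] dmin] :
    exists2 d, (exists2 h, H h & zspan s (h - y *~ d)) &
      forall k, (exists2 h, H h & zspan s (h - y *~ k)) -> (d %| k)%Z.
  apply: int_subgroup; split=> [|k l [h Hh hk] [g Hg gl]].
    by exists 0; [case: sH|rewrite mulr0z subr0; apply: span0].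
  exists (h - g); first exact: (proj2 sH).
  suff -> : h - g - y *~ (k - l) = (h - y *~ k) - (g - y *~ l) by apply: spanB.
  by rewrite mulrzBr !opprB addrACA [- g + _]addrC -addrACA.
exists (h :: t) => x; split=> [Hx|].
  have [k xk] := Hs x Hx.
  have /dvdzP[q kE] : (d %| k)%Z by apply: dmin; exists x.
  exists q; apply/tE; split; first by apply: (proj2 sH) => //; apply: subgroupMz.
  have -> : x - q *: (h : zmodule V) = (x - y *~ k) - (h - y *~ d) *~ q.
    by rewrite scalezrE mulrzBl -mulrzA kE [d * q]mulrC opprB addrA subrK.
  by apply: spanB => //; apply: subgroupMz => //; apply: zspan_subgroup.
move=> [q /tE[Hx _]]; rewrite -[x](subrK (h *~ q)).
by apply: subgroupD => //; apply: subgroupMz.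
Qed.

(** The ascending chain condition, in the form in which it is used: the union of
the subgroups generated by initial segments of the sequence is finitely
generated, hence reached at a finite stage. *)
Lemma noetherian (x : nat -> V) : fg_abelian V ->
  ~ (forall k, ~ zspan (rev (mkseq x k)) (x k)).
Proof.
move=> /fg_abelianP[n [e /generates_zspan gen]] xk.
pose st k := zspan (rev (mkseq x k)).
have st_leq k l y : (k <= l)%N -> st k y -> st l y.
  move=> /subnKC <-; elim: (l - k)%N => [|j IHj]; first by rewrite addn0.
  by move=> /IHj ky; rewrite addnS /st mkseqS rev_rcons; apply: span_cons.
pose H y := exists k, st k y.
have sH : subgroup H.
  split=> [|y z [k ky] [l lz]]; first by exists 0%N; apply: span0.
  exists (maxn k l); apply: spanB.
    by apply: st_leq ky; apply: leq_maxl.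
  by apply: st_leq lz; apply: leq_maxr.
have [t tE] := subgroup_fg sH (fun y _ => gen y).
have [K tK] : exists K, {in t, forall y, st K y}.
  have : {in t, forall y, H y} by move=> y yt; apply/tE; apply: mem_span.
  elim: t {tE} => [|y t IHt] Ht; first by exists 0%N.
  have [K tK] := IHt (fun z zt => Ht z (mem_behead (s := y :: t) zt)).
  have [k ky] := Ht y (mem_head _ _).
  exists (maxn k K) => z; rewrite inE => /orP[/eqP ->|/tK zK].
    by apply: st_leq ky; apply: leq_maxl.
  by apply: st_leq zK; apply: leq_maxr.
apply: (xk K); apply: (@zspan_min V (st K) t) => //; first exact: zspan_subgroup.
apply/tE; exists K.+1; apply: mem_span.
by rewrite mkseqS rev_rcons mem_head.
Qed.

End Noetherian.

(** * Prime filtrations *)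

Definition ideal_pred (A : comPzRingType) (P : A -> Prop) : Prop :=
  subgroup P /\ forall a b, P b -> P (a * b).

Definition prime_pred (A : comPzRingType) (P : A -> Prop) : Prop :=
  ~ P 1 /\ forall a b, P (a * b) -> P a \/ P b.

Definition annihilator (A : comPzRingType) (L : lmodType A) (s : seq L) (x : L)
  : A -> Prop := fun a => span s (a *: x).

(** A prime filtration: every entry generates, modulo the span of the following
ones, a copy of the quotient of A by a prime ideal. *)
Fixpoint prime_chain (A : comPzRingType) (L : lmodType A) (s : seq L) : Prop :=
  if s is m :: r then prime_pred (annihilator r m) /\ prime_chain r else True.

Lemma annihilator_ideal (A : comPzRingType) (L : lmodType A) (s : seq L) x :
  ideal_pred (annihilator s x).
Proof.
split; first split=> [|a b sa sb]; first by rewrite /annihilator scale0r; apply: span0.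
  by rewrite /annihilator scalerBl; apply: spanB.
by move=> a b sb; rewrite /annihilator -scalerA; apply: spanZ.
Qed.

(** Annihilators that are maximal among those of elements outside the span are
prime: if P is the annihilator of y, and P contains a * b but neither factor,
then b *: y has a strictly larger annihilator. *)
Lemma exists_prime_annihilator (A : comPzRingType) (L : lmodType A) (s : seq L) x :
  FDZ_scalar_ring A -> ~ span s x -> exists y, prime_pred (annihilator s y).
Proof.
move=> fgA sx; apply: contrapT => /forallNP noP.
pose X := {y : L | ~ span s y}.
have step (y : X) : exists za : X * A, [/\ annihilator s (sval za.1) za.2,
    ~ annihilator s (sval y) za.2 &
    forall c, annihilator s (sval y) c -> annihilator s (sval za.1) c].
  case: y => y sy; apply: contrapT => noy; apply: (noP y); split=> [|a b Pab].
    by rewrite /annihilator scale1r.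
  have [Pb|nPb] := pselect (annihilator s y b); [by right|left].
  apply: contrapT => nPa; apply: noy; exists (exist _ (b *: y) nPb, a); split=> //=.
    by rewrite /annihilator scalerA.
  by move=> c Pc; rewrite /annihilator scalerA mulrC -scalerA; apply: spanZ.
have [f fP] := choice step.
pose y k := iter k (fun z => (f z).1) (exist _ x sx : X).
apply: (@noetherian A (fun k => (f (y k)).2) fgA) => k.
have [_ + _] := fP (y k); apply: contra_not; apply: zspan_min.
  by case: (annihilator_ideal s (sval (y k))).
elim: k => // k IHk a; rewrite mkseqS rev_rcons inE => /orP[/eqP ->|/IHk].
  by have [] := fP (y k).
by have [_ _] := fP (y k); apply.
Qed.

(** As long as the entries do not span L, an element with prime annihilator modulo
their span can be added; this stops by the ascending chain condition. *)
Lemma exists_prime_chain (A : comPzRingType) (L : lmodType A) :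
    FDZ_scalar_ring A -> fg_abelian L ->
  exists2 s : seq L, prime_chain s & forall x, span s x.
Proof.
move=> fgA fgL; apply: contrapT => no.
pose X := {s : seq L | prime_chain s}.
have step (s : X) : exists m, prime_pred (annihilator (sval s) m).
  case: s => s cs; have /existsNP[x sx] : ~ forall x, span s x.
    by move=> sT; apply: no; exists s.
  exact: exists_prime_annihilator sx.
have [f fP] := choice step.
pose g (s : X) : X := exist _ (f s :: sval s) (conj (fP s) (svalP s)).
pose y k := iter k g (exist _ nil I : X).
apply: (@noetherian L (fun k => f (y k)) fgL) => k kx.
have yE : rev (mkseq (fun k => f (y k)) k) = sval (y k).
  by elim: k {kx} => // k IHk; rewrite mkseqS rev_rcons IHk.
have [+ _] := fP (y k); apply; rewrite /annihilator scale1r -yE.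
apply: zspan_min kx => [|z zs]; last exact: mem_span.
by split=> [|z t]; [apply: span0|apply: spanB].
Qed.

Lemma inj_surj_bijective (T U : Type) (f : T -> U) :
  injective f -> (forall y, exists x, f x = y) -> bijective f.
Proof. by move=> f_inj /choice[g gK]; exists g => // x; apply: f_inj. Qed.

(** The map f induces bijections between the residue rings that are attached to
the entries of s and to those of its image. *)
Fixpoint chain_bijective (A B : comPzRingType) (L : lmodType A) (K : lmodType B)
    (f : A -> B) (phi : L -> K) (s : seq L) : Prop :=
  if s is m :: r then
    [/\ forall b, exists a, annihilator (map phi r) (phi m) (b - f a),
        forall a, annihilator (map phi r) (phi m) (f a) -> annihilator r m a
      & chain_bijective f phi r]
  else True.

(** The five lemma, applied successively to the extensions of which the
filtration consists. *)
Lemma chain_bijectiveP (A B : comPzRingType) (L : lmodType A) (K : lmodType B)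
    (f : A -> B) (phi : {additive L -> K}) (s : seq L) :
    (forall a x, phi (a *: x) = f a *: phi x) ->
    (forall x, span s x) -> (forall y, span (map phi s) y) ->
    chain_bijective f phi s ->
  bijective phi.
Proof.
move=> phiZ sL sK; have span_phi r x : span r x -> span (map phi r) (phi x).
  elim: r x => [|m r IHr] x /=; first by move=> ->; rewrite raddf0.
  by move=> [a /IHr]; rewrite raddfB phiZ => ?; exists (f a).
move=> bij.
have [surj inj] : (forall y, span (map phi s) y -> exists2 x, span s x & phi x = y) /\
    (forall x, span s x -> phi x = 0 -> x = 0).
  elim: s bij {sL sK} => [_|m r IHr /= [surjm injm bij]].
    split=> [y /= ->|x /= -> //]; exists 0 => //; exact: raddf0.
  have [surj inj] := IHr bij; split=> [y [b yb]|x [a xa] x0].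
    have [a ba] := surjm b.
    have /surj[x rx xE] : span (map phi r) (y - f a *: phi m).
      have -> : y - f a *: phi m = (y - b *: phi m) + (b - f a) *: phi m.
        by rewrite scalerBl addrA subrK.
      exact: spanD.
    exists (x + a *: m); first by exists a; rewrite addrK.
    by rewrite raddfD phiZ xE subrK.
  have ra : annihilator r m a.
    apply: injm; have := span_phi _ _ xa; rewrite raddfB x0 sub0r phiZ.
    by move=> /spanN; rewrite opprK.
  by apply: inj x0; rewrite -[x](subrK (a *: m)); apply: spanD.
apply: inj_surj_bijective => [x y xy|y].
  apply/eqP; rewrite -subr_eq0; apply/eqP; apply: inj => //.
  by rewrite raddfB xy subrr.
by have [x _ xE] := surj y (sK y); exists x.
Qed.

(** * Quotient rings *)

Local Open Scope quotient_scope.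
(** Neither B nor its quotient need be nontrivial, so the multiplication is put by
hand on the quotient of the additive group. *)
Section QuotientRing.
Variables (B : comPzRingType) (P : B -> Prop) (idP : ideal_pred P).

Definition ideal_mem : pred B := fun x => `[< P x >].

Lemma ideal_mem_closed : zmod_closed ideal_mem.
Proof.
have [[P0 PB] _] := idP.
by split=> [|x y /asboolP Px /asboolP Py]; apply/asboolP => //; apply: PB.
Qed.

HB.instance Definition _ := GRing.isZmodClosed.Build B ideal_mem ideal_mem_closed.

Definition quot_ring := Quotient.quot (GRing.ZmodClosed.clone B ideal_mem _).
HB.instance Definition _ := GRing.Zmodule.on quot_ring.
HB.instance Definition _ := Quotient.on quot_ring.

Let pi (x : B) : quot_ring := \pi_quot_ring x.

Lemma pi_eq x y : (pi x = pi y) <-> P (x - y).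
Proof.
split=> [/eqP|Pxy]; last apply/eqP.
  by rewrite /pi piE /Quotient.equiv => /asboolP.
by rewrite /pi piE /Quotient.equiv; apply/asboolP.
Qed.

Let one : quot_ring := pi 1.
Let mul (x y : quot_ring) : quot_ring := pi (repr x * repr y).

Lemma pi_repr x : pi (repr x) = x. Proof. exact: reprK. Qed.

Lemma pi_mul x y : mul (pi x) (pi y) = pi (x * y).
Proof.
have [sP PM] := idP.
apply/pi_eq; rewrite -[X in X - _](subrK (repr (pi x) * y)) -mulrBr -addrA -mulrBl.
apply: subgroupD => //; first by apply: PM; apply/pi_eq; rewrite pi_repr.
by rewrite mulrC; apply: PM; apply/pi_eq; rewrite pi_repr.
Qed.

Lemma quot_mulA : associative mul.
Proof. by move=> x y z; rewrite -[x]pi_repr -[y]pi_repr -[z]pi_repr !pi_mul mulrA. Qed.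

Lemma quot_mulC : commutative mul.
Proof. by move=> x y; rewrite /mul mulrC. Qed.

Lemma quot_mul1 : left_id one mul.
Proof. by move=> x; rewrite -[x]pi_repr pi_mul mul1r. Qed.

Lemma piD x y : pi (x + y) = pi x + pi y.
Proof. exact: Quotient.pi_add. Qed.

Lemma quot_mulDl : left_distributive mul +%R.
Proof.
move=> x y z; rewrite -[x]pi_repr -[y]pi_repr -[z]pi_repr.
by rewrite -piD !pi_mul mulrDl piD.
Qed.

HB.instance Definition _ := GRing.Zmodule_isComPzRing.Build quot_ring
  quot_mulA quot_mulC quot_mul1 quot_mulDl.

Lemma pi_zmod : zmod_morphism pi.
Proof. by move=> x y; have := piD (x - y) y; rewrite subrK => ->; rewrite addrK. Qed.

Lemma pi_monoid : monoid_morphism pi.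
Proof. by split=> // x y; rewrite -pi_mul. Qed.

HB.instance Definition _ := GRing.isZmodMorphism.Build B quot_ring pi pi_zmod.
HB.instance Definition _ := GRing.isMonoidMorphism.Build B quot_ring pi pi_monoid.

Lemma exists_quotient : exists (Q : comPzRingType) (p : {rmorphism B -> Q}),
  (forall y, exists x, p x = y) /\ (forall x, p x = 0 <-> P x).
Proof.
exists quot_ring, pi; split=> [y|x]; first by exists (repr y); exact: pi_repr.
by rewrite -[x in P x]subr0 -pi_eq (raddf0 pi).
Qed.

End QuotientRing.

(** * Trace forms and bounded denominators *)

Lemma mulmx_row_eq m n (A B : 'M[int]_(m, n)) :
  (forall l : 'rV_m, l *m A = l *m B) -> A = B.
Proof. by move=> AB; apply/row_matrixP => i; rewrite !rowE AB. Qed.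

Definition fun_mx (W V : zmodType) m n (e : 'I_n -> V) (gen : generates e)
    (b : 'I_m -> W) (h : W -> V) : 'M[int]_(m, n) :=
  \matrix_i coord gen (h (b i)).

Lemma comb_fun_mx (W V : zmodType) m n (e : 'I_n -> V) (gen : generates e)
    (b : 'I_m -> W) (h : W -> V) l :
  comb e (l *m fun_mx gen b h) = comb (h \o b) l.
Proof.
by rewrite comb_mulmx; apply: eq_comb => i; rewrite rowK coordK.
Qed.

Section Trace.
Variables (O : comPzRingType) (n : nat) (u : 'I_n -> O).
Hypotheses (gen : generates u) (ind : independent u).

Definition mul_mx (x : O) : 'M[int]_n := fun_mx gen u ( *%R x).

Lemma comb_mul_mx x l : comb u (l *m mul_mx x) = x * comb u l.
Proof.
by rewrite comb_fun_mx mulr_sumr; apply: eq_bigr => i _; rewrite mulrzAr.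
Qed.

Definition rtrace (x : O) : int := \tr (mul_mx x).

Lemma rtrace_is_zmod : zmod_morphism rtrace.
Proof.
move=> x y; rewrite /rtrace -linearB /=; congr mxtrace.
apply: mulmx_row_eq => l; apply: (comb_inj ind).
by rewrite mulmxBr combB !comb_mul_mx mulrBl.
Qed.
HB.instance Definition _ := GRing.isZmodMorphism.Build O int rtrace rtrace_is_zmod.

Lemma rtraceMz x (k : int) : rtrace (x *~ k) = rtrace x *~ k.
Proof. exact: raddfMz. Qed.

Lemma rtrace1 : rtrace 1 = n%:Z.
Proof.
rewrite /rtrace (_ : mul_mx 1 = 1%:M) ?mxtrace1 ?natz //.
apply: mulmx_row_eq => l; apply: (comb_inj ind).
by rewrite comb_mul_mx mul1r mulmx1.
Qed.

Hypothesis dom : forall x y : O, x * y = 0 -> x = 0 \/ y = 0.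

(** The integer is the determinant of the multiplication by x, and z comes from
the adjugate matrix. *)
Lemma divides_integer (x : O) : x <> 0 ->
  exists (z : O) (N : int), N <> 0 /\ x * z = N%:~R.
Proof.
move=> x0; exists (comb u (coord gen 1 *m \adj (mul_mx x))), (\det (mul_mx x)).
split; last first.
  rewrite -comb_mul_mx -mulmxA mul_adj_mx mul_mx_scalar combZ coordK //.
move=> /eqP/det0P[v /eqP v0 vx]; have := comb0 u.
rewrite -vx comb_mul_mx => /dom[//|] v0'; apply: v0; exact: ind.
Qed.

Hypothesis one0 : 1 <> 0 :> O.

Definition trace_form : 'M[int]_n := \matrix_(i, j) rtrace (u i * u j).

Lemma row_trace_form l j : (l *m trace_form) 0 j = rtrace (comb u l * u j).
Proof.
rewrite mxE mulr_suml raddf_sum; apply: eq_bigr => i _.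
by rewrite mxE mulrzAl raddfMz mulrzz mulrC.
Qed.

(** A nonzero x in the radical of the trace form divides a nonzero integer N, but
the trace of N is n * N. *)
Lemma trace_form_neq0 : \det trace_form <> 0.
Proof.
move=> /eqP/det0P[v /eqP v0 vG].
have [/ind//|z [N [N0 zN]]] := divides_integer (x := comb u v).
have tr0 y : rtrace (comb u v * y) = 0.
  rewrite -[y](coordK gen) mulr_sumr raddf_sum big1 // => i _.
  by rewrite mulrzAr raddfMz /= -row_trace_form vG mxE mul0rz.
have := tr0 z; rewrite zN raddfMz /= rtrace1 mulrzz => /eqP.
rewrite mulf_eq0 => /orP[/eqP[n0]|/eqP//].
apply: one0; rewrite -(coordK gen 1) /comb big1 // => i _.
by case: i => i ltin; exfalso; rewrite n0 in ltin.
Qed.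
End Trace.

Section Overring.
Variables (O D : comPzRingType) (g : {rmorphism O -> D}).
Variables (n m : nat) (u : 'I_n -> O) (b : 'I_m -> D).
Hypotheses (genu : generates u) (indu : independent u).
Hypotheses (genb : generates b) (indb : independent b).
Hypothesis g_inj : injective g.
Variable k : int.
Hypotheses (k0 : k <> 0) (kD : forall y, exists x, y *~ k = g x).

(** Let C express u in terms of b, and C' express k b in terms of u, so that
C *m C' and C' *m C are both k.  The two matrices of the multiplication by x
are intertwined by C, hence have the same trace. *)
Lemma rtrace_overring x : rtrace genb (g x) = rtrace genu x.
Proof.
have [h hE] := choice kD.
pose C := fun_mx genb u g; pose C' := fun_mx genu b h.
have CE l : comb b (l *m C) = g (comb u l) by rewrite comb_fun_mx raddf_comb.
have C'E l : g (comb u (l *m C')) = comb b l *~ k.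
  rewrite comb_fun_mx raddf_comb /comb mulrz_suml; apply: eq_bigr => i _ /=.
  by rewrite -hE -!mulrzA mulrC.
have C'C : C' *m C = k%:M.
  apply: mulmx_row_eq => l; apply: (comb_inj indb).
  by rewrite mulmxA CE C'E mul_mx_scalar combZ.
have CC' : C *m C' = k%:M.
  apply: mulmx_row_eq => l; apply: (comb_inj indu); apply: g_inj.
  by rewrite mulmxA C'E CE mul_mx_scalar combZ raddfMz.
have SC : mul_mx genu x *m C = C *m mul_mx genb (g x).
  apply: mulmx_row_eq => l; apply: (comb_inj indb).
  by rewrite !mulmxA CE !comb_mul_mx rmorphM CE.
have : \tr (mul_mx genu x *m C *m C') = \tr (C' *m C *m mul_mx genb (g x)).
  by rewrite SC mxtrace_mulC mulmxA.
rewrite -mulmxA CC' C'C mul_mx_scalar mul_scalar_mx !mxtraceZ => /mulfI trE.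
by apply/esym/trE/eqP.
Qed.

Hypothesis tfD : torsion_free D.

(** If k y = q u with integral q, then the traces of y u_j are integers, which
means that q times the Gram matrix of the trace form is divisible by k.
Multiplying by the adjugate matrix, so is q times the discriminant. *)
Lemma overring_denominator y :
  exists x, y *~ \det (trace_form genu) = g x.
Proof.
have [x yx] := kD y; pose q := coord genu x.
pose t : 'rV_n := \row_j rtrace genb (y * g (u j)).
have qG : q *m trace_form genu = k *: t.
  apply/rowP => j; rewrite row_trace_form // coordK !mxE -rtrace_overring.
  by rewrite rmorphM -yx mulrzAl rtraceMz // mulrzz mulrC.
exists (comb u (t *m \adj (trace_form genu))).
have : g (comb u (q *m trace_form genu *m \adj (trace_form genu))) =
    g (comb u (k *: t *m \adj (trace_form genu))).
  by rewrite qG.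
rewrite -mulmxA mul_mx_adj mul_mx_scalar -scalemxAl !combZ coordK !raddfMz /= -yx.
move=> /eqP; rewrite -mulrzA mulrC mulrzA -subr_eq0 -mulrzBl => /eqP/tfD[//|/eqP].
by rewrite subr_eq0 => /eqP.
Qed.
End Overring.

Section OddIndex.
Variables (D : comPzRingType) (H : D -> Prop).
Hypotheses (fgD : FDZ_scalar_ring D) (sH : subgroup H).
Hypothesis HD : forall y, exists x z, H x /\ y = x + z *~ 2.

(** Write the generators w of D as w = h + 2 W w with h in H.  Then (1 - 2 W) w lies
in H, and so does k w for the determinant k of 1 - 2 W, which is odd. *)
Lemma odd_index : exists2 k : int, k <> 0 & forall y, H (y *~ k).
Proof.
have /fg_abelianP[n [w gen]] := fgD.
have /choice[h hE] y : exists z, H (y - z *~ 2).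
  by have [x [z [Hx ->]]] := HD y; exists z; rewrite addrK.
pose W := fun_mx gen w h; pose K := 1%:M - 2 *: W.
have KH l : H (comb w (l *m K)).
  rewrite mulmxBr mulmx1 -scalemxAr combB combZ comb_fun_mx.
  rewrite /comb mulrz_suml -sumrB; apply: big_ind => [|x y|i _].
  - by case: sH.
  - exact: subgroupD.
  by rewrite -!mulrzA [_ * 2]mulrC mulrzA -mulrzBl; apply: subgroupMz.
exists (\det K); last first.
  move=> y; have := KH (coord gen y *m \adj K).
  by rewrite -mulmxA mul_adj_mx mul_mx_scalar combZ coordK.
move=> /(congr1 (intr : int -> 'F_2)); rewrite -det_map_mx rmorph0.
suff -> : map_mx (intr : int -> 'F_2) K = 1%:M by rewrite det1.
apply/matrixP => i j; rewrite !mxE rmorphB rmorphM /= rmorph_nat.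
by rewrite [2%:~R](_ : _ = 0) ?mul0r ?subr0 ?natz //; apply/val_inj.
Qed.
End OddIndex.

(** If n = 0 in D for some n > 0, then either n is even and n / 2 = 0, or n is odd
and - (n - 1) / 2 is an inverse of 2. *)
Lemma domain_torsion_free (D : comPzRingType) :
    (forall x y : D, x * y = 0 -> x = 0 \/ y = 0) -> (2%:R : D) <> 0 ->
    (forall y : D, y *~ 2 <> 1) ->
  torsion_free D.
Proof.
move=> dom two0 two1.
have char0 (n : nat) : (n.+1%:R : D) <> 0.
  elim/ltn_ind: n => n IHn; have := odd_double_half n.+1.
  case: (odd n.+1); rewrite -muln2 ?add0n => nE n0.
    apply: (two1 (- (n.+1./2)%:R)); rewrite mulNrz -[RHS]opprK; congr (- _).
    move: n0; rewrite -{1}nE natrD natrM mulr_natr addrC => n0.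
    by apply/eqP; rewrite -addr_eq0; apply/eqP.
  have hn : (n.+1./2 <= n)%N 
    by rewrite -ltnS ltn_half_double -addnn -[X in (X < _)%N]addn0 ltn_add2l.
  case: (n.+1./2) hn nE => [|h hn nE]; first by [].
  by move: n0; rewrite -nE natrM => /dom[|//]; apply: IHn.
move=> x k; rewrite -mulrzl => /dom[H|]; last by right.
left; case: (intP k) H => // n.
  by move=> n0; case: (char0 n).
by move=> /eqP; rewrite mulrNz oppr_eq0 => /eqP n0; case: (char0 n).
Qed.

(** * Free variables, existential closure and invariance under isomorphism *)

Section Agreement.
Variables (A : comPzRingType) (M : lmodType A).
Implicit Types (v : nat -> M) (w : nat -> A).

Lemma meval_agree v v' t : {in mterm_vars t, v =1 v'} -> meval v t = meval v' t.
Proof.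
elim: t => //= [i|t IHt|t IHt u IHu] vv'.
- by apply: vv'; rewrite inE.
- by rewrite IHt.
- by rewrite IHt ?IHu // => i it; apply: vv'; rewrite mem_cat it ?orbT.
Qed.

Lemma aeval_agree w w' t : {in aterm_vars t, w =1 w'} -> aeval w t = aeval w' t.
Proof.
elim: t => //= [i|t IHt|t IHt u IHu|t IHt u IHu] ww'.
- by apply: ww'; rewrite inE.
- by rewrite IHt.
- by rewrite IHt ?IHu // => i it; apply: ww'; rewrite mem_cat it ?orbT.
- by rewrite IHt ?IHu // => i it; apply: ww'; rewrite mem_cat it ?orbT.
Qed.

Lemma upd_agree (T : Type) (s : seq nat) (v v' : nat -> T) i x :
  {in [seq j <- s | j != i], v =1 v'} -> {in s, upd v i x =1 upd v' i x}.
Proof.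
move=> vv' j js; rewrite /upd; case: eqVneq => // ji.
by apply: vv'; rewrite mem_filter ji.
Qed.

Lemma holds_agree f v v' w w' :
    {in free_mvars f, v =1 v'} -> {in free_avars f, w =1 w'} ->
  holds v w f <-> holds v' w' f.
Proof.
have catl (T : Type) (s t : seq nat) (a b : nat -> T) :
    {in s ++ t, a =1 b} -> {in s, a =1 b}.
  by move=> ab i si; apply: ab; rewrite mem_cat si.
have catr (T : Type) (s t : seq nat) (a b : nat -> T) :
    {in s ++ t, a =1 b} -> {in t, a =1 b}.
  by move=> ab i ti; apply: ab; rewrite mem_cat ti orbT.
elim: f v v' w w' => /= [t u|t u|t a u|g IHg|g IHg h IHh|g IHg h IHh|g IHg h IHh
    |i g IHg|i g IHg|i g IHg|i g IHg] v v' w w' vv' ww'.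
- by rewrite (meval_agree (catl _ _ _ _ _ vv')) (meval_agree (catr _ _ _ _ _ vv')).
- by rewrite (aeval_agree (catl _ _ _ _ _ ww')) (aeval_agree (catr _ _ _ _ _ ww')).
- rewrite (meval_agree (catl _ _ _ _ _ vv')) (meval_agree (catr _ _ _ _ _ vv')).
  by rewrite (aeval_agree ww').
- by have := IHg _ _ _ _ vv' ww'; tauto.
- have := IHg _ _ _ _ (catl _ _ _ _ _ vv') (catl _ _ _ _ _ ww').
  by have := IHh _ _ _ _ (catr _ _ _ _ _ vv') (catr _ _ _ _ _ ww'); tauto.
- have := IHg _ _ _ _ (catl _ _ _ _ _ vv') (catl _ _ _ _ _ ww').
  by have := IHh _ _ _ _ (catr _ _ _ _ _ vv') (catr _ _ _ _ _ ww'); tauto.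
- have := IHg _ _ _ _ (catl _ _ _ _ _ vv') (catl _ _ _ _ _ ww').
  by have := IHh _ _ _ _ (catr _ _ _ _ _ vv') (catr _ _ _ _ _ ww'); tauto.
- have E x : holds (upd v i x) w g <-> holds (upd v' i x) w' g.
    by apply: IHg => //; apply: upd_agree.
  by split=> H x; apply/E.
- have E x : holds (upd v i x) w g <-> holds (upd v' i x) w' g.
    by apply: IHg => //; apply: upd_agree.
  by split=> -[x /E]; exists x.
- have E x : holds v (upd w i x) g <-> holds v' (upd w' i x) g.
    by apply: IHg => //; apply: upd_agree.
  by split=> H x; apply/E.
- have E x : holds v (upd w i x) g <-> holds v' (upd w' i x) g.
    by apply: IHg => //; apply: upd_agree.
  by split=> -[x /E]; exists x.
Qed.

End Agreement.

(** The free variables of f serve as parameters; this turns the existence of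
parameters into a sentence. *)
Definition ex_closure (f : formula) : formula :=
  foldr FExM (foldr FExA f (free_avars f)) (free_mvars f).

Lemma free_foldr_FExA f s :
  free_mvars (foldr FExA f s) = free_mvars f /\
  free_avars (foldr FExA f s) = [seq j <- free_avars f | j \notin s].
Proof.
elim: s => /= [|i s [-> ->]]; first by rewrite filter_predT.
by split=> //; rewrite -filter_predI; apply: eq_filter => j /=; rewrite inE negb_or.
Qed.

Lemma free_foldr_FExM f s :
  free_avars (foldr FExM f s) = free_avars f /\
  free_mvars (foldr FExM f s) = [seq j <- free_mvars f | j \notin s].
Proof.
elim: s => /= [|i s [-> ->]]; first by rewrite filter_predT.
by split=> //; rewrite -filter_predI; apply: eq_filter => j /=; rewrite inE negb_or.
Qed.

Lemma ex_closure_sentence f : is_sentence (ex_closure f).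
Proof.
have filterNmem (s : seq nat) : [seq j <- s | j \notin s] = [::].
  apply/eqP; rewrite -(negbK (_ == _)) -has_filter.
  by apply/hasPn => j js; rewrite negbK.
rewrite /ex_closure; split.
  by rewrite (free_foldr_FExM _ _).2 (free_foldr_FExA _ _).1 filterNmem.
by rewrite (free_foldr_FExM _ _).1 (free_foldr_FExA _ _).2 filterNmem.
Qed.

Lemma holds_foldr_FExA (A : comPzRingType) (M : lmodType A) f s
    (v : nat -> M) (w : nat -> A) :
  holds v w (foldr FExA f s) <->
  exists2 w' : nat -> A, (forall j, j \notin s -> w' j = w j) & holds v w' f.
Proof.
elim: s w => [|i s IHs] w /=.
  split=> [H|[w' w'w H]]; first by exists w.
  by rewrite (_ : w = w') //; apply: funext => j; rewrite w'w.
split=> [[a /IHs[w' w'w H]]|[w' w'w H]].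
  exists w' => // j; rewrite inE negb_or => /andP[ji js].
  by rewrite w'w // /upd (negPf ji).
exists (w' i); apply/IHs; exists w' => // j js; rewrite /upd.
by case: eqVneq => [->//|ji]; apply: w'w; rewrite inE negb_or ji.
Qed.

Lemma holds_foldr_FExM (A : comPzRingType) (M : lmodType A) f s
    (v : nat -> M) (w : nat -> A) :
  holds v w (foldr FExM f s) <->
  exists2 v' : nat -> M, (forall j, j \notin s -> v' j = v j) & holds v' w f.
Proof.
elim: s v => [|i s IHs] v /=.
  split=> [H|[v' v'v H]]; first by exists v.
  by rewrite (_ : v = v') //; apply: funext => j; rewrite v'v.
split=> [[a /IHs[v' v'v H]]|[v' v'v H]].
  exists v' => // j; rewrite inE negb_or => /andP[ji js].
  by rewrite v'v // /upd (negPf ji).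
exists (v' i); apply/IHs; exists v' => // j js; rewrite /upd.
by case: eqVneq => [->//|ji]; apply: v'v; rewrite inE negb_or ji.
Qed.

Lemma models_ex_closure (A : comPzRingType) (M : lmodType A) f :
  models M (ex_closure f) <-> exists (v : nat -> M) (w : nat -> A), holds v w f.
Proof.
split=> [/(_ (fun=> 0) (fun=> 0))/holds_foldr_FExM[v _ /holds_foldr_FExA[w _ H]]|].
  by exists v, w.
move=> [v [w H]] v0 w0; apply/holds_foldr_FExM.
exists (fun j => if j \in free_mvars f then v j else v0 j) => [j /negPf ->//|].
apply/holds_foldr_FExA.
exists (fun j => if j \in free_avars f then w j else w0 j) => [j /negPf ->//|].
by apply: (iffLR (holds_agree _ _) H) => j ->.
Qed.

Section Invariance.
Variables (A B : comPzRingType) (M : lmodType A) (N : lmodType B).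
Variables (th1 : {additive M -> N}) (th2 : {rmorphism A -> B}).
Hypotheses (bij1 : bijective th1) (bij2 : bijective th2).
Hypothesis act : forall m a n, act_pred m a n <-> act_pred (th1 m) (th2 a) (th1 n).

Lemma meval_iso v t : meval (th1 \o v) t = th1 (meval v t).
Proof.
elim: t => //= [|t ->|t -> u ->]; first by rewrite raddf0.
  by rewrite raddfN.
by rewrite raddfD.
Qed.

Lemma aeval_iso w t : aeval (th2 \o w) t = th2 (aeval w t).
Proof.
elim: t => //= [||t ->|t -> u ->|t -> u ->]; rewrite ?rmorph0 ?rmorph1 ?rmorphN //.
  by rewrite rmorphD.
by rewrite rmorphM.
Qed.

Lemma comp_upd (T U : Type) (h : T -> U) v i x : h \o upd v i x = upd (h \o v) i (h x).
Proof. by apply: funext => j; rewrite /upd /=; case: eqP. Qed.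

Lemma holds_iso f v w : holds v w f <-> holds (th1 \o v) (th2 \o w) f.
Proof.
have [g1 gK1 Kg1] := bij1; have [g2 gK2 Kg2] := bij2.
elim: f v w => /= [t u|t u|t a u|g IHg|g IHg h IHh|g IHg h IHh|g IHg h IHh
    |i g IHg|i g IHg|i g IHg|i g IHg] v w.
- by rewrite !meval_iso; split=> [->//|/(bij_inj bij1)].
- by rewrite !aeval_iso; split=> [->//|/(bij_inj bij2)].
- by rewrite !meval_iso aeval_iso.
- by have := IHg v w; tauto.
- by have := IHg v w; have := IHh v w; tauto.
- by have := IHg v w; have := IHh v w; tauto.
- by have := IHg v w; have := IHh v w; tauto.
- split=> H x; last by apply/IHg; rewrite comp_upd.
  by rewrite -[x]Kg1 -comp_upd; apply/IHg.
- split=> -[x H]; first by exists (th1 x); rewrite -comp_upd; apply/IHg.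
  by exists (g1 x); apply/IHg; rewrite comp_upd Kg1.
- split=> H x; last by apply/IHg; rewrite comp_upd.
  by rewrite -[x]Kg2 -comp_upd; apply/IHg.
- split=> -[x H]; first by exists (th2 x); rewrite -comp_upd; apply/IHg.
  by exists (g2 x); apply/IHg; rewrite comp_upd Kg2.
Qed.
End Invariance.

Lemma models_iso (A B : comPzRingType) (M : lmodType A) (N : lmodType B) f :
  module_iso N M -> models M f -> models N f.
Proof.
move=> [th1 [th2 [b1 b2 act]]] mod v w.
by apply/(holds_iso b1 b2 act).
Qed.

(** * Building formulas together with their meaning *)

(** A formula that is parametrized by a number from which on variable names are
fresh. *)
Definition lformula := nat -> formula.

Definition lf_const (f : formula) : lformula := fun=> f.
Definition lf_not (F : lformula) : lformula := fun i => FNot (F i).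
Definition lf_and (F G : lformula) : lformula := fun i => FAnd (F i) (G i).
Definition lf_or (F G : lformula) : lformula := fun i => FOr (F i) (G i).
Definition lf_imp (F G : lformula) : lformula := fun i => FImp (F i) (G i).
Definition lf_allM (F : mterm -> lformula) : lformula :=
  fun i => FAllM i (F (MVar i) i.+1).
Definition lf_exM (F : mterm -> lformula) : lformula :=
  fun i => FExM i (F (MVar i) i.+1).
Definition lf_allA (F : aterm -> lformula) : lformula :=
  fun i => FAllA i (F (AVar i) i.+1).
Definition lf_exA (F : aterm -> lformula) : lformula :=
  fun i => FExA i (F (AVar i) i.+1).
Definition lf_bigand (T : Type) (F : T -> lformula) (s : seq T) : lformula :=
  foldr (fun x => lf_and (F x)) (lf_const (FEqM MZero MZero)) s.
Definition lf_bigor (T : Type) (F : T -> lformula) (s : seq T) : lformula :=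
  foldr (fun x => lf_or (F x)) (lf_const (FNot (FEqM MZero MZero))) s.

Section Denotation.
Variables (A : comPzRingType) (M : lmodType A).

(** An environment in which only the variables below [level] are in use. *)
Record world := World { level : nat; menv : nat -> M; aenv : nat -> A }.

Definition extends (W W' : world) : Prop :=
  [/\ (level W <= level W')%N,
      forall i, (i < level W)%N -> menv W' i = menv W i
    & forall i, (i < level W)%N -> aenv W' i = aenv W i].

Lemma extends_refl W : extends W W. Proof. by []. Qed.

Lemma extends_trans W1 W2 W3 : extends W1 W2 -> extends W2 W3 -> extends W1 W3.
Proof.
move=> [l12 m12 a12] [l23 m23 a23]; split=> [|i il|i il].
- exact: leq_trans l23.
- by rewrite m23 ?m12 // (leq_trans il).
- by rewrite a23 ?a12 // (leq_trans il).
Qed.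

(** Denotations are required in all extensions of the world, which makes them
stable under the introduction of bound variables. *)
Definition mden W (t : mterm) (x : M) : Prop :=
  forall W', extends W W' -> meval (menv W') t = x.
Definition aden W (t : aterm) (a : A) : Prop :=
  forall W', extends W W' -> aeval (aenv W') t = a.
Definition fden W (F : lformula) (P : Prop) : Prop :=
  forall W', extends W W' -> holds (menv W') (aenv W') (F (level W')) <-> P.

Lemma mdenW W W' t x : extends W W' -> mden W t x -> mden W' t x.
Proof. by move=> WW' tx W2 W'2; apply: tx; apply: extends_trans W'2. Qed.
Lemma adenW W W' t x : extends W W' -> aden W t x -> aden W' t x.
Proof. by move=> WW' tx W2 W'2; apply: tx; apply: extends_trans W'2. Qed.
Lemma mden_var W i : (i < level W)%N -> mden W (MVar i) (menv W i).
Proof. by move=> il W' [_ mW _]; apply: mW. Qed.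
Lemma mden0 W : mden W MZero 0. Proof. by []. Qed.
Lemma mdenN W t x : mden W t x -> mden W (MOpp t) (- x).
Proof. by move=> tx W' WW' /=; rewrite tx. Qed.
Lemma mdenD W t u x y : mden W t x -> mden W u y -> mden W (MAdd t u) (x + y).
Proof. by move=> tx uy W' WW' /=; rewrite tx ?uy. Qed.

Lemma aden_var W i : (i < level W)%N -> aden W (AVar i) (aenv W i).
Proof. by move=> il W' [_ _ aW]; apply: aW. Qed.
Lemma aden0 W : aden W AZero 0. Proof. by []. Qed.
Lemma adenN W t x : aden W t x -> aden W (AOpp t) (- x).
Proof. by move=> tx W' WW' /=; rewrite tx. Qed.
Lemma adenD W t u x y : aden W t x -> aden W u y -> aden W (AAdd t u) (x + y).
Proof. by move=> tx uy W' WW' /=; rewrite tx ?uy. Qed.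
Lemma adenM W t u x y : aden W t x -> aden W u y -> aden W (AMul t u) (x * y).
Proof. by move=> tx uy W' WW' /=; rewrite tx ?uy. Qed.

Lemma fden_eqM W t u x y : mden W t x -> mden W u y ->
  fden W (lf_const (FEqM t u)) (x = y).
Proof. by move=> tx uy W' WW' /=; rewrite tx ?uy. Qed.
Lemma fden_eqA W t u x y : aden W t x -> aden W u y ->
  fden W (lf_const (FEqA t u)) (x = y).
Proof. by move=> tx uy W' WW' /=; rewrite tx ?uy. Qed.
Lemma fden_act W t a u x b y : mden W t x -> aden W a b -> mden W u y ->
  fden W (lf_const (FAct t a u)) (b *: x = y).
Proof. by move=> tx ab uy W' WW' /=; rewrite tx ?uy ?ab. Qed.
Lemma fden_not W F P : fden W F P -> fden W (lf_not F) (~ P).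
Proof. by move=> FP W' /FP /=; tauto. Qed.
Lemma fden_and W F P G Q : fden W F P -> fden W G Q -> fden W (lf_and F G) (P /\ Q).
Proof. by move=> FP GQ W' WW' /=; have := FP _ WW'; have := GQ _ WW'; tauto. Qed.
Lemma fden_or W F P G Q : fden W F P -> fden W G Q -> fden W (lf_or F G) (P \/ Q).
Proof. by move=> FP GQ W' WW' /=; have := FP _ WW'; have := GQ _ WW'; tauto. Qed.
Lemma fden_imp W F P G Q : fden W F P -> fden W G Q -> fden W (lf_imp F G) (P -> Q).
Proof. by move=> FP GQ W' WW' /=; have := FP _ WW'; have := GQ _ WW'; tauto. Qed.

Lemma fden_iff W F P Q : (P <-> Q) -> fden W F P -> fden W F Q.
Proof. by move=> PQ FP W' /FP; tauto. Qed.

Lemma extends_updM W x :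
  extends W (World (level W).+1 (upd (menv W) (level W) x) (aenv W)).
Proof. by split=> //= i il; rewrite /upd ltn_eqF. Qed.
Lemma extends_updA W a :
  extends W (World (level W).+1 (menv W) (upd (aenv W) (level W) a)).
Proof. by split=> //= i il; rewrite /upd ltn_eqF. Qed.

(** The bound variable of a quantifier denotes its value in the world in which the
level has been raised by one. *)
Lemma fden_freshM W (F : mterm -> lformula) (Q : M -> Prop) :
    (forall W' t x, extends W W' -> mden W' t x -> fden W' (F t) (Q x)) ->
  forall W' x, extends W W' ->
    holds (upd (menv W') (level W') x) (aenv W') (F (MVar (level W')) (level W').+1)
      <-> Q x.
Proof.
move=> FQ W' x WW'.
set W2 := World (level W').+1 (upd (menv W') (level W') x) (aenv W').
have W'2 : extends W' W2 by apply: extends_updM.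
have := mden_var (W := W2) (ltnSn (level W')); rewrite /= /upd eqxx => vx.
by apply: FQ (extends_refl W2) => //; apply: extends_trans W'2.
Qed.

Lemma fden_freshA W (F : aterm -> lformula) (Q : A -> Prop) :
    (forall W' t x, extends W W' -> aden W' t x -> fden W' (F t) (Q x)) ->
  forall W' x, extends W W' ->
    holds (menv W') (upd (aenv W') (level W') x) (F (AVar (level W')) (level W').+1)
      <-> Q x.
Proof.
move=> FQ W' x WW'.
set W2 := World (level W').+1 (menv W') (upd (aenv W') (level W') x).
have W'2 : extends W' W2 by apply: extends_updA.
have := aden_var (W := W2) (ltnSn (level W')); rewrite /= /upd eqxx => vx.
by apply: FQ (extends_refl W2) => //; apply: extends_trans W'2.
Qed.

Section Quantifiers.
Variable W : world.

Lemma fden_allM (F : mterm -> lformula) (Q : M -> Prop) :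
    (forall W' t x, extends W W' -> mden W' t x -> fden W' (F t) (Q x)) ->
  fden W (lf_allM F) (forall x, Q x).
Proof.
move=> FQ W' WW'; have E x := fden_freshM FQ x WW'.
by split=> H x; apply/E.
Qed.

Lemma fden_exM (F : mterm -> lformula) (Q : M -> Prop) :
    (forall W' t x, extends W W' -> mden W' t x -> fden W' (F t) (Q x)) ->
  fden W (lf_exM F) (exists x, Q x).
Proof.
move=> FQ W' WW'; have E x := fden_freshM FQ x WW'.
by split=> -[x /E]; exists x.
Qed.

Lemma fden_allA (F : aterm -> lformula) (Q : A -> Prop) :
    (forall W' t x, extends W W' -> aden W' t x -> fden W' (F t) (Q x)) ->
  fden W (lf_allA F) (forall x, Q x).
Proof.
move=> FQ W' WW'; have E x := fden_freshA FQ x WW'.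
by split=> H x; apply/E.
Qed.

Lemma fden_exA (F : aterm -> lformula) (Q : A -> Prop) :
    (forall W' t x, extends W W' -> aden W' t x -> fden W' (F t) (Q x)) ->
  fden W (lf_exA F) (exists x, Q x).
Proof.
move=> FQ W' WW'; have E x := fden_freshA FQ x WW'.
by split=> -[x /E]; exists x.
Qed.

End Quantifiers.

Lemma fden_bigand (T : eqType) W (F : T -> lformula) (Q : T -> Prop) (s : seq T) :
  (forall x, fden W (F x) (Q x)) ->
  fden W (lf_bigand F s) (forall x, x \in s -> Q x).
Proof.
move=> FQ; elim: s => [|y s IHs]; first by [].
apply: (fden_iff _ (fden_and (FQ y) IHs)); split=> [[Qy Qs] x|H].
  by rewrite inE => /orP[/eqP ->//|/Qs].
by split=> [|x xs]; apply: H; rewrite inE ?eqxx // xs orbT.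
Qed.

Lemma fden_bigor (T : eqType) W (F : T -> lformula) (Q : T -> Prop) (s : seq T) :
  (forall x, fden W (F x) (Q x)) ->
  fden W (lf_bigor F s) (exists2 x, x \in s & Q x).
Proof.
move=> FQ; elim: s => [|y s IHs].
  by move=> W' WW' /=; split=> [|[]] //; move/(_ erefl).
apply: (fden_iff _ (fden_or (FQ y) IHs)); split=> [[Qy|[x xs Qx]]|[x]].
- by exists y => //; rewrite mem_head.
- by exists x => //; rewrite inE xs orbT.
by rewrite inE => /orP[/eqP ->|xs]; [left|right; exists x].
Qed.

End Denotation.

(** The same term serves for both sorts. *)
Definition comb_term (T : Type) (zero : T) (opp : T -> T) (add : T -> T -> T)
    n (ts : 'I_n -> T) (k : 'rV[int]_n) : T :=
  let mul t (z : int) := match z with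
    | Posz m => iter m (add t) zero
    | Negz m => opp (iter m.+1 (add t) zero) end in
  foldr (fun i => add (mul (ts i) (k 0 i))) zero (index_enum 'I_n).

Lemma comb_termP (T : Type) (zero : T) (opp : T -> T) (add : T -> T -> T)
    (V : zmodType) (den : T -> V -> Prop) n (ts : 'I_n -> T) (xs : 'I_n -> V) k :
    den zero 0 -> (forall t x, den t x -> den (opp t) (- x)) ->
    (forall t u x y, den t x -> den u y -> den (add t u) (x + y)) ->
    (forall i, den (ts i) (xs i)) ->
  den (comb_term zero opp add ts k) (comb xs k).
Proof.
move=> d0 dN dD dts; rewrite /comb_term /comb unlock.
have diter t x m : den t x -> den (iter m (add t) zero) (x *+ m).
  by move=> tx; elim: m => // m IHm; rewrite iterS mulrS; apply: dD.
elim: index_enum => //= i s IHs; apply: dD => //.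
case: (k 0 i) => m; first by rewrite -pmulrn; apply: diter.
by rewrite NegzE -nmulrn; apply: dN; apply: (diter _ _ m.+1).
Qed.

Definition mcomb := comb_term MZero MOpp MAdd.
Definition acomb := comb_term AZero AOpp AAdd.

Lemma mden_comb (A : comPzRingType) (M : lmodType A) (W : world M) n
    (ts : 'I_n -> mterm) (xs : 'I_n -> M) k :
  (forall i, mden W (ts i) (xs i)) -> mden W (mcomb ts k) (comb xs k).
Proof.
apply: comb_termP; [exact: mden0|exact: mdenN|exact: mdenD].
Qed.

Lemma aden_comb (A : comPzRingType) (M : lmodType A) (W : world M) n
    (ts : 'I_n -> aterm) (xs : 'I_n -> A) k :
  (forall i, aden W (ts i) (xs i)) -> aden W (acomb ts k) (comb xs k).
Proof.
apply: comb_termP; [exact: aden0|exact: adenN|exact: adenD].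
Qed.

(** * Detecting a residue ring: the finite case *)

Lemma generates_image (V W : zmodType) (p : {additive V -> W}) n (e : 'I_n -> V) :
  (forall y, exists x, p x = y) -> generates e -> generates (p \o e).
Proof.
move=> surj gen y; have [x <-] := surj y; have [k ->] := gen x.
by exists k; rewrite raddf_comb.
Qed.

Lemma rmorphism_factor (A O D : comPzRingType) (p : {rmorphism A -> O})
    (h : {rmorphism A -> D}) :
    (forall y, exists x, p x = y) -> (forall x, p x = 0 -> h x = 0) ->
  exists g : {rmorphism O -> D}, forall x, g (p x) = h x.
Proof.
move=> /choice[s sK] ker; pose g y := h (s y).
have gp x : g (p x) = h x.
  by apply/eqP; rewrite -subr_eq0 -rmorphB; apply/eqP/ker; rewrite rmorphB /= sK subrr.
have gB : zmod_morphism g by move=> x y; rewrite -[x]sK -[y]sK -rmorphB !gp rmorphB.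
have gM : monoid_morphism g.
  split=> [|x y]; first by rewrite -(rmorph1 p) gp rmorph1.
  by rewrite -[x]sK -[y]sK -rmorphM !gp rmorphM.
pose am := GRing.isZmodMorphism.Build O D g gB.
pose mm := GRing.isMonoidMorphism.Build O D g gM.
pose G : {rmorphism O -> D} := HB.pack g am mm.
by exists G.
Qed.

(** Remainders modulo d of integral vectors; they range over a finite type. *)
Definition digits d n (c : {ffun 'I_n -> 'I_d}) : 'rV[int]_n :=
  \row_i (c i : nat)%:Z.

Lemma digitsP d n (k : 'rV[int]_n) : (0 < d)%N ->
  exists (c : {ffun 'I_n -> 'I_d}) (q : 'rV[int]_n), k = digits c + d%:Z *: q.
Proof.
move=> d0; have d0' : d%:Z != 0 by rewrite -absz_eq0 -lt0n.
have ltd (i : 'I_n) : (`|(k 0%R i %% d)%Z| < d)%N.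
  by rewrite -ltz_nat gez0_abs ?modz_ge0 // ltz_mod.
exists [ffun i => Ordinal (ltd i)], (\row_i (k 0%R i %/ d)%Z).
apply/rowP => i; rewrite !mxE ffunE /= gez0_abs ?modz_ge0 //.
by rewrite addrC mulrC -divz_eq.
Qed.

Lemma digits_divisible d n (c : {ffun 'I_n -> 'I_d}) (q : 'rV[int]_n) :
  digits c = d%:Z *: q -> digits c = 0.
Proof.
move=> cq; apply/rowP => i; have := congr1 (fun M : 'rV[int]_n => M 0 i) cq.
rewrite !mxE => cE; have : (d %| c i)%N.
  by have := dvdz_mulr (q 0 i) (dvdzz d%:Z); rewrite -cE.
by rewrite /dvdn modn_small // => /eqP ->.
Qed.

Definition ascale (t : aterm) (z : int) : aterm := acomb (fun _ : 'I_1 => t) z%:M.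

Lemma aden_scale (A : comPzRingType) (M : lmodType A) (W : world M) t a z :
  aden W t a -> aden W (ascale t z) (a *~ z).
Proof.
move=> ta; rewrite (_ : a *~ z = comb (fun _ : 'I_1 => a) z%:M).
  exact: aden_comb.
by rewrite /comb big_ord1 mxE eqxx mulr1n.
Qed.

Definition asub (t u : aterm) := AAdd t (AOpp u).

Lemma aden_sub (A : comPzRingType) (M : lmodType A) (W : world M) t u a b :
  aden W t a -> aden W u b -> aden W (asub t u) (a - b).
Proof. by move=> ta ub; apply: adenD => //; apply: adenN. Qed.

(** The conditions that will be imposed on the image of the generators of A and on
the ideal P' of B. *)
Definition ideal_property n :=
  forall B : comPzRingType, ('I_n -> B) -> (B -> Prop) -> Prop.

(** The formula I, with a term plugged in, says that the value of this term lies
in P. *)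
Definition represents (B : comPzRingType) (N : lmodType B) (W : world N)
    (I : aterm -> lformula) (P : B -> Prop) : Prop :=
  forall W' t b, extends W W' -> aden W' t b -> fden W' (I t) (P b).

Definition expressible n (Q : ideal_property n) : Prop :=
  exists chi : ('I_n -> aterm) -> (aterm -> lformula) -> lformula,
    forall (B : comPzRingType) (N : lmodType B) (W : world N) ts e I P,
      (forall i, aden W (ts i) (e i)) -> represents W I P ->
    fden W (chi ts I) (Q B e P).

(** The condition Q forces f to induce a bijection from A / P to B / P'. *)
Definition detects (A : comPzRingType) n (e : 'I_n -> A) (P : A -> Prop)
    (Q : ideal_property n) : Prop :=
  forall (B : comPzRingType) (f : {rmorphism A -> B}) (P' : B -> Prop),
    FDZ_scalar_ring B -> ideal_pred P' -> (forall a, P a -> P' (f a)) ->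
    Q B (f \o e) P' ->
  (forall b, exists a, P' (b - f a)) /\ (forall a, P' (f a) -> P a).

Section FiniteResidue.
Variables (A : comPzRingType) (n : nat) (e : 'I_n -> A) (P : A -> Prop) (d : nat).
Hypotheses (gen : generates e) (idP : ideal_pred P) (d0 : (0 < d)%N) (Pd : P d%:R).

Let T : finType := {ffun 'I_n -> 'I_d}.
Let nonmembers : seq T :=
  [seq c <- index_enum T | `[< ~ P (comb e (digits c)) >]].

(** The combinations of e with coefficients below d represent all classes modulo P,
as d annihilates A / P.  The same is required in B, and representatives of nonzero
classes must stay nonzero. *)
Definition finite_property : ideal_property n := fun B e' P' =>
  (forall x, exists2 c : T, c \in index_enum T & P' (x - comb e' (digits c))) /\
  (forall c : T, c \in nonmembers -> ~ P' (comb e' (digits c))).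

Lemma finite_property_expressible : expressible finite_property.
Proof.
exists (fun ts I => lf_and
  (lf_allA (fun x => lf_bigor (fun c : T => I (asub x (acomb ts (digits c))))
     (index_enum T)))
  (lf_bigand (fun c : T => lf_not (I (acomb ts (digits c)))) nonmembers)).
move=> B N W ts e' I P' te IP'; apply: fden_and.
  apply: fden_allA => W' t x WW' tx; apply: fden_bigor => c.
  apply: IP' => //; apply: aden_sub => //; apply: aden_comb => i.
  exact: adenW (te i).
by apply: fden_bigand => c; apply: fden_not; apply: IP' => //; apply: aden_comb.
Qed.

Lemma finite_residue x : exists c : {ffun 'I_n -> 'I_d}, P (x - comb e (digits c)).
Proof.
have [[sP PM] [k ->]] := (idP, gen x); have [c [q ->]] := digitsP k d0.
exists c; rewrite combD addrC addKr combZ -mulrzr; apply: PM.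
by rewrite -[d%:~R]/(d%:R).
Qed.

Lemma finite_property_holds : finite_property e P.
Proof.
split=> [x|c]; first by have [c] := finite_residue x; exists c; rewrite ?mem_index_enum.
by rewrite mem_filter => /andP[/asboolP].
Qed.

Lemma finite_property_detects : detects e P finite_property.
Proof.
move=> B f P' _ [sP' _] PP' [Qall Qnot]; split=> [b|a Pa].
  by have [c _ ?] := Qall b; exists (comb e (digits c)); rewrite raddf_comb.
have [c ac] := finite_residue a; have [sP _] := idP.
rewrite -[a](subrK (comb e (digits c))); apply: subgroupD => //.
apply: contrapT => nPc; apply: (Qnot c).
  by rewrite mem_filter mem_index_enum andbT; apply/asboolP.
rewrite -raddf_comb -[comb e _](subKr a) raddfB.
by apply: (proj2 sP') => //; apply: PP'.
Qed.
End FiniteResidue.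

(** * Detecting a residue ring: characteristic zero *)

Section InfiniteResidue.
Variables (n r d : nat) (U : 'M[int]_(r, n)).

Let digit_vectors b : finType := {ffun 'I_r -> 'I_b}.
Let nonzero_digits : seq (digit_vectors d) :=
  [seq c <- index_enum (digit_vectors d) | digits c != 0].

(** The rows of U express the basis u of A / P in terms of e, and d will be the
absolute value of the discriminant of A / P.  The first two clauses make B / P' a
torsion-free domain, the third one bounds its rank, and the last one excludes that
it is larger than A / P. *)
Definition domain_property : ideal_property n := fun B e P =>
  (forall x y, P (x * y) -> P x \/ P y) /\
  (~ P (1 *~ 2) /\ forall y, ~ P (y *~ 2 - 1)) /\
  (forall x, exists y, exists2 c : digit_vectors 2, c \in index_enum (digit_vectors 2) &
     P (x - comb e (digits c *m U) - y *~ 2)) /\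
  (forall c : digit_vectors d, c \in nonzero_digits ->
     forall y, ~ P (y *~ d - comb e (digits c *m U))).

Lemma domain_property_expressible : expressible domain_property.
Proof.
exists (fun ts I => lf_and
  (lf_allA (fun x => lf_allA (fun y => lf_imp (I (AMul x y)) (lf_or (I x) (I y)))))
  (lf_and (lf_and (lf_not (I (ascale AOne 2)))
     (lf_allA (fun y => lf_not (I (asub (ascale y 2) AOne)))))
  (lf_and (lf_allA (fun x => lf_exA (fun y => lf_bigor (fun c : digit_vectors 2 =>
        I (asub (asub x (acomb ts (digits c *m U))) (ascale y 2)))
      (index_enum (digit_vectors 2)))))
   (lf_bigand (fun c : digit_vectors d => lf_allA (fun y =>
      lf_not (I (asub (ascale y d) (acomb ts (digits c *m U)))))) nonzero_digits)))).
move=> B N W ts e P P' te PP'.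
apply: fden_and; last apply: fden_and; last apply: fden_and.
- apply: fden_allA => W1 x1 x WW1 x1x; apply: fden_allA => W2 y1 y W12 y1y.
  have WW2 := extends_trans WW1 W12; have x2x := adenW W12 x1x.
  by apply: fden_imp; [|apply: fden_or]; apply: PP' => //; apply: adenM.
- apply: fden_and; first by apply: fden_not; apply: PP' => //; apply: aden_scale.
  apply: fden_allA => W1 y1 y WW1 y1y; apply: fden_not; apply: PP' => //.
  by apply: aden_sub => //; apply: aden_scale.
- apply: fden_allA => W1 x1 x WW1 x1x; apply: fden_exA => W2 y1 y W12 y1y.
  have WW2 := extends_trans WW1 W12; have x2x := adenW W12 x1x.
  apply: fden_bigor => c; apply: PP' => //; apply: aden_sub; last exact: aden_scale.
  by apply: aden_sub => //; apply: aden_comb => i; apply: adenW (te i).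
- apply: fden_bigand => c; apply: fden_allA => W1 y1 y WW1 y1y.
  apply: fden_not; apply: PP' => //; apply: aden_sub; first exact: aden_scale.
  by apply: aden_comb => i; apply: adenW (te i).
Qed.

Variables (A O : comPzRingType) (e : 'I_n -> A) (P : A -> Prop).
Variables (p : {rmorphism A -> O}) (u : 'I_r -> O).
Hypotheses (p_surj : forall y, exists x, p x = y) (kerp : forall x, p x = 0 <-> P x).
Hypotheses (genu : generates u) (indu : independent u).
Hypothesis uE : forall k, p (comb e (k *m U)) = comb u k.
Hypothesis dom : forall x y : O, x * y = 0 -> x = 0 \/ y = 0.
Hypotheses (tf : torsion_free O) (one0 : 1 <> 0 :> O).
Hypothesis dE : d = `|\det (trace_form genu)|%N.

Let d_gt0 : (0 < d)%N.
Proof.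
by rewrite dE absz_gt0; apply/eqP; apply: trace_form_neq0.
Qed.

Lemma domain_property_holds : domain_property e P.
Proof.
have r_gt0 : (0 < r)%N.
  rewrite lt0n; apply/eqP => r0; apply: one0.
  rewrite -(coordK genu 1) /comb big1 // => i _.
  by case: i => i ltir; exfalso; rewrite r0 in ltir.
split=> [x y /kerp|]; first by rewrite rmorphM => /dom[] /kerp; [left|right].
split; first split=> [/kerp|y /kerp].
- by rewrite raddfMz /= rmorph1 => /tf[].
- rewrite raddfB raddfMz /= rmorph1 => /eqP; rewrite subr_eq0 => /eqP py.
  (* otherwise every basis vector would be divisible by 2 *)
  pose i := Ordinal r_gt0; pose k := coord genu (p y * u i).
  have kE : comb u (delta_mx 0 i) = comb u (2 *: k).
    by rewrite combZ coordK comb_delta -mulrzAl py mul1r.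
  have two : 1 = 2 * k 0%R i :> int.
    have := congr1 (fun M : 'rV[int]_r => M 0 i) (comb_inj indu kE).
    by rewrite !mxE !eqxx.
  by have := dvdz_mulr (k 0 i) (dvdzz 2); rewrite -two.
split=> [x|c].
  have [c [q kE]] := digitsP (coord genu (p x)) (ltn0Sn 1).
  have [y yE] := p_surj (comb u q).
  exists y, c; rewrite ?mem_index_enum //; apply/kerp.
  rewrite !raddfB raddfMz /= uE yE -[p x](coordK genu) kE combD combZ.
  by rewrite addrAC addrK subrr.
rewrite mem_filter => /andP[/eqP c0 _] y /kerp.
rewrite raddfB raddfMz /= uE -[p y](coordK genu) -combZ => /eqP.
by rewrite subr_eq0 => /eqP/(comb_inj indu)/esym/digits_divisible.
Qed.

(** With D = B / P' and O = A / P, the third clause yields an odd index of O in D,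
whence d y lies in O for every y in D; the last clause then shows that the
coordinates of d y are divisible by d, so that y lies in O. *)
Lemma domain_property_detects : detects e P domain_property.
Proof.
move=> B f P' fgB idP' PP' [domP' [[two0 two1] [mod2 nodiv]]].
have [D [p' [p'_surj kerp']]] := exists_quotient idP'.
have domD (x y : D) : x * y = 0 -> x = 0 \/ y = 0.
  have [[x' <-] [y' <-]] := (p'_surj x, p'_surj y).
  by rewrite -rmorphM !kerp'; apply: domP'.
have tfD : torsion_free D.
  apply: domain_torsion_free => // [H|y].
    by apply: two0; apply/kerp'; rewrite raddfMz /= rmorph1.
  have [y' <-] := p'_surj y => H; apply: (two1 y'); apply/kerp'.
  by rewrite raddfB raddfMz /= rmorph1 H subrr.
have oneD : 1 <> 0 :> D.
  by move=> H; apply: two0; apply/kerp'; rewrite raddfMz /= rmorph1 H mul0rz.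
have fgD : FDZ_scalar_ring D.
  have /fg_abelianP[m [b gb]] := fgB; apply/fg_abelianP; exists m, (p' \o b).
  exact: generates_image.
have [g gE] : exists g : {rmorphism O -> D}, forall a, g (p a) = p' (f a).
  apply: (rmorphism_factor (h := p' \o f)) => // a /kerp Pa.
  by apply/kerp'; apply: PP'.
have g_comb k : g (comb u k) = p' (comb (f \o e) (k *m U)).
  by rewrite -uE gE raddf_comb.
have g_inj : injective g.
  move=> x y xy; apply/eqP; rewrite -subr_eq0; apply/negPn/negP => /eqP xy0.
  have [z [N [N0 zN]]] := divides_integer genu indu dom xy0.
  have : g ((x - y) * z) = 0 by rewrite rmorphM rmorphB xy subrr mul0r.
  by rewrite zN rmorph_int => /tfD[].
have [k k0 kD] : exists2 k : int, k <> 0 & forall y : D, exists x, y *~ k = g x.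
  apply: (odd_index (H := fun y => exists x, y = g x)) => // [|y].
    split=> [|x y [x' ->] [y' ->]]; first by exists 0; rewrite rmorph0.
    by exists (x' - y'); rewrite rmorphB.
  have [y' <-] := p'_surj y; have [z' [c _ /kerp']] := mod2 y'.
  rewrite !raddfB /= -g_comb raddfMz => /eqP; rewrite -addrA -opprD subr_eq0 => /eqP ->.
  by exists (g (comb u (digits c))), (p' z'); split=> //; exists (comb u (digits c)).
have /fg_abelianP[m [b0 gb0]] := fgD.
have [m' [b [genb indb]]] := exists_basis tfD gb0.
(* d is the discriminant up to sign *)
have denom y : exists x, y *~ d = g x.
  have [x xE] := overring_denominator genu indu genb indb g_inj k0 kD tfD y.
  have [-> | ->] : d = \det (trace_form genu) :> int \/
      d = - \det (trace_form genu) :> int.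
    by rewrite dE; case: (intP (\det _)) => [|j|j]; [left|left|right; rewrite opprK].
  - by exists x.
  - by exists (- x); rewrite mulrNz xE rmorphN.
have surj y : exists x, y = g x.
  have [x xE] := denom y.
  have [c [q kE]] := digitsP (coord genu x) d_gt0.
  pose z := y - g (comb u q).
  have zE : z *~ d = g (comb u (digits c)).
    by rewrite mulrzBl xE -raddfMz -combZ -{1}(coordK genu x) kE combD raddfD addrK.
  have [z' z'z] := p'_surj z.
  have c0 : digits c = 0.
    apply: contrapT => c0; apply: (nodiv c _ z').
      by rewrite mem_filter mem_index_enum andbT; apply/eqP.
    by apply/kerp'; rewrite raddfB raddfMz /= z'z zE g_comb subrr.
  move: zE; rewrite c0 comb0 rmorph0 => /tfD[d0|/eqP].
    by move: d_gt0; case: d0 => ->.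
  by rewrite subr_eq0 => /eqP yE; exists (comb u q).
split=> [b'|a Pa].
  have [o oE] := surj (p' b'); have [a aE] := p_surj o.
  by exists a; apply/kerp'; rewrite rmorphB /= oE -aE gE subrr.
by apply/kerp/g_inj; rewrite gE rmorph0; apply/kerp'.
Qed.

End InfiniteResidue.

Lemma prime_detectable (A : comPzRingType) n (e : 'I_n -> A) (P : A -> Prop) :
    generates e -> ideal_pred P -> prime_pred P ->
  exists Q : ideal_property n, [/\ expressible Q, Q A e P & detects e P Q].
Proof.
move=> gen idP [P1 Pprime].
have [[d d0 Pd]|no] := pselect (exists2 d : nat, (0 < d)%N & P d%:R).
  exists (finite_property e P d); split.
  - exact: finite_property_expressible.
  - exact: finite_property_holds.
  - exact: finite_property_detects.
have [O [p [p_surj kerp]]] := exists_quotient idP.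
have dom (x y : O) : x * y = 0 -> x = 0 \/ y = 0.
  have [[x' <-] [y' <-]] := (p_surj x, p_surj y).
  by rewrite -rmorphM !kerp; apply: Pprime.
have one0 : 1 <> 0 :> O by rewrite -(rmorph1 p) => /kerp.
have tf : torsion_free O.
  move=> x k; rewrite -mulrzl => /dom[k0|]; [left|by right].
  apply: contrapT => /eqP k'; apply: no; exists `|k|%N; first by rewrite absz_gt0.
  apply/kerp; rewrite rmorph_nat.
  by case: (intP k) k0 {k'} => // j; rewrite mulrNz => /eqP; rewrite oppr_eq0 => /eqP.
have genp := generates_image p_surj gen.
have [r [u [genu indu]]] := exists_basis tf genp.
pose U := fun_mx genp u id.
have uE k : p (comb e (k *m U)) = comb u k.
  by rewrite raddf_comb comb_fun_mx.
exists (domain_property `|\det (trace_form genu)| U); split.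
- exact: domain_property_expressible.
- exact: (domain_property_holds _ p_surj kerp genu indu uE dom tf one0).
- exact: (@domain_property_detects _ _ _ _ _ _ _ _ _ _
    p_surj kerp genu indu uE dom one0 erefl).
Qed.

(** * Generators and relations *)

Lemma generates_ind (V : zmodType) n (e : 'I_n -> V) (H : V -> Prop) :
  generates e -> subgroup H -> (forall i, H (e i)) -> forall x, H x.
Proof.
move=> gen sH He x; have [k ->] := gen x.
apply: (big_ind H); first by case: sH.
  by move=> y z; apply: subgroupD.
by move=> i _; apply: subgroupMz.
Qed.

Lemma zspan_fg_abelian (V : zmodType) (s : seq V) :
  (forall x, zspan s x) -> fg_abelian V.
Proof.
move=> sV; apply/fg_abelianP; exists (size s), (fun i => s`_i) => x.
move: (sV x) => {sV}; elim: s x => [|y s IHs] x /=.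
  by move=> ->; exists 0; rewrite comb0.
move=> [a /IHs[k kE]]; exists (\row_i oapp (k 0) a (unlift ord0 i)).
rewrite /comb big_ord_recl mxE unlift_none /= -[LHS](subrK (y *~ a)) addrC.
by rewrite [x - _]kE; congr (_ + _); apply: eq_bigr => i _; rewrite mxE liftK.
Qed.

Lemma fg_module_abelian (A : comPzRingType) (M : lmodType A) :
  FDZ_scalar_ring A -> fg_module M -> fg_abelian M.
Proof.
move=> /fg_abelianP[n [e gen]] [m [b bM]].
pose s := [seq e i *: b`_j | i : 'I_n <- enum 'I_n, j : 'I_m <- enum 'I_m].
have ss := zspan_subgroup s.
apply: (@zspan_fg_abelian _ s) => x; have [c ->] := bM x.
apply: (big_ind (zspan s)); first by case: ss.
  by move=> y z; apply: subgroupD.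
move=> j _; pose H a := zspan s (a *: b`_j); apply: (@generates_ind _ _ e H) => // [|i].
  split=> [|a a' Ha Ha']; first by rewrite /H scale0r; case: ss.
  by rewrite /H scalerBl; apply: (proj2 ss).
by apply: mem_span; apply/allpairsP; exists (i, j); rewrite /= !mem_enum.
Qed.

Lemma fg_abelian_pair (V W : zmodType) :
  fg_abelian V -> fg_abelian W -> fg_abelian (V * W)%type.
Proof.
move=> /fg_abelianP[n [e gene]] /fg_abelianP[m [h genh]].
pose s := [seq (e i, 0 : W) | i : 'I_n] ++ [seq (0 : V, h i) | i : 'I_m].
have ss := zspan_subgroup s.
apply: (@zspan_fg_abelian _ s) => -[x y].
have -> : (x, y) = (x, 0) + (0, y) by apply/eqP; rewrite xpair_eqE /= addr0 add0r !eqxx.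
apply: subgroupD => //.
  apply: (@generates_ind _ _ e (fun x => zspan s (x, 0))) => // [|i].
    split=> [|a b Ha Hb]; first by case: ss.
    by have := proj2 ss _ _ Ha Hb; congr zspan;
    apply/eqP; rewrite xpair_eqE /= subr0 !eqxx.
  by apply: mem_span; rewrite mem_cat; apply/orP; left; apply: image_f.
apply: (@generates_ind _ _ h (fun y => zspan s (0, y))) => // [|i].
  split=> [|a b Ha Hb]; first by case: ss.
  by have := proj2 ss _ _ Ha Hb; congr zspan;
    apply/eqP; rewrite xpair_eqE /= subr0 !eqxx.
by apply: mem_span; rewrite mem_cat; apply/orP; right; apply: image_f.
Qed.

(** The relations form a subgroup of a finitely generated abelian group. *)
Lemma relations_fg (V : zmodType) n (e : 'I_n -> V) :
  exists R : seq 'rV[int]_n, forall k, comb e k = 0 <-> zspan R k.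
Proof.
have gen : generates (fun i : 'I_n => delta_mx 0 i : 'rV[int]_n).
  move=> k; exists k; rewrite {1}[k]row_sum_delta; apply: eq_bigr => i _.
  by rewrite -[X in X *: _]intz scaler_int.
apply: (subgroup_fg (s := codom (fun i : 'I_n => delta_mx 0 i : 'rV[int]_n))) => [|k _].
  by split=> [|k l ek el]; rewrite ?comb0 // combB ek el subrr.
exact: generates_zspan.
Qed.

Lemma additive_extension (V W : zmodType) n (e : 'I_n -> V) (e' : 'I_n -> W) :
    generates e -> (forall k, comb e k = 0 -> comb e' k = 0) ->
  exists h : {additive V -> W}, forall k, h (comb e k) = comb e' k.
Proof.
move=> gen rel; pose h x := comb e' (coord gen x).
have hE k : h (comb e k) = comb e' k.
  apply/eqP; rewrite -subr_eq0 -combB; apply/eqP/rel.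
  by rewrite combB coordK subrr.
have hB : zmod_morphism h.
  by move=> x y; rewrite -{1}(coordK gen x) -{1}(coordK gen y) -combB hE combB.
pose mh := GRing.isZmodMorphism.Build V W h hB.
by exists (HB.pack h mh : {additive V -> W}).
Qed.

Section Presentation.
Variables (A B : comPzRingType) (M : lmodType A) (N : lmodType B).
Variables (n m : nat) (e : 'I_n -> A) (g : 'I_m -> M) (e' : 'I_n -> B) (g' : 'I_m -> N).
Hypotheses (gene : generates e) (geng : generates g).
Hypothesis rel_e : forall k, comb e k = 0 -> comb e' k = 0.
Hypothesis rel_g : forall k, comb g k = 0 -> comb g' k = 0.
Hypothesis mul_e : forall i j, e' i * e' j = comb e' (coord gene (e i * e j)).
Hypothesis one_e : 1 = comb e' (coord gene 1).
Hypothesis act_g : forall i j, e' i *: g' j = comb g' (coord geng (e i *: g j)).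

Lemma presented_morphism :
  exists (f : {rmorphism A -> B}) (phi : {additive M -> N}),
    [/\ f \o e = e', phi \o g = g' & forall a x, phi (a *: x) = f a *: phi x].
Proof.
have [f fE] := additive_extension gene rel_e.
have [phi phiE] := additive_extension geng rel_g.
have fe i : f (e i) = e' i by rewrite -comb_delta fE comb_delta.
have phig i : phi (g i) = g' i by rewrite -comb_delta phiE comb_delta.
have fM : monoid_morphism f.
  split=> [|x y]; first by rewrite -[in LHS](coordK gene 1) fE -one_e.
  apply: (generates_ind (H := fun x => f (x * y) = f x * f y) gene) => [|i].
    split=> [|a b Ha Hb]; first by rewrite mul0r raddf0 mul0r.
    by rewrite mulrBl !raddfB /= Ha Hb mulrBl.
  apply: (generates_ind (H := fun y => f (e i * y) = f (e i) * f y) gene) => [|j].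
    split=> [|a b Ha Hb]; first by rewrite mulr0 raddf0 mulr0.
    by rewrite mulrBr !raddfB /= Ha Hb mulrBr.
  by rewrite -(coordK gene (e i * e j)) fE -mul_e !fe.
pose mf := GRing.isMonoidMorphism.Build A B f fM.
pose af := GRing.isZmodMorphism.Build A B f (raddfB f).
pose F : {rmorphism A -> B} := HB.pack (f : A -> B) af mf.
exists F, phi; split=> [||a x]; try exact: funext.
apply: (generates_ind (H := fun a => phi (a *: x) = f a *: phi x) gene) => [|i].
  split=> [|b c Hb Hc]; first by rewrite scale0r !raddf0 scale0r.
  by rewrite scalerBl !raddfB /= Hb Hc scalerBl.
apply: (generates_ind (H := fun x => phi (e i *: x) = f (e i) *: phi x) geng) => [|j].
  split=> [|b c Hb Hc]; first by rewrite scaler0 raddf0 scaler0.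
  by rewrite scalerBr !raddfB Hb Hc.
by rewrite -(coordK geng (e i *: g j)) phiE -act_g fe phig.
Qed.
End Presentation.

Lemma module_iso_inv (A B : comPzRingType) (M : lmodType A) (N : lmodType B)
    (f : {rmorphism A -> B}) (phi : {additive M -> N}) :
    bijective f -> bijective phi -> (forall a x, phi (a *: x) = f a *: phi x) ->
  module_iso N M.
Proof.
move=> [f' fK f'K] [phi' phiK phi'K] phiZ.
have phi'B : zmod_morphism phi'.
  by move=> x y; rewrite -{1}[x]phi'K -{1}[y]phi'K -raddfB phiK.
have f'B : zmod_morphism f'.
  by move=> x y; rewrite -{1}[x]f'K -{1}[y]f'K -raddfB fK.
have f'M : monoid_morphism f'.
  split=> [|x y]; first by rewrite -[in LHS](rmorph1 f) fK.
  by rewrite -{1}[x]f'K -{1}[y]f'K -rmorphM fK.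
pose m1 := GRing.isZmodMorphism.Build N M phi' phi'B.
pose m2 := GRing.isZmodMorphism.Build B A f' f'B.
pose m3 := GRing.isMonoidMorphism.Build B A f' f'M.
exists (HB.pack phi' m1 : {additive N -> M}), (HB.pack f' m2 m3 : {rmorphism B -> A}).
split; [by exists phi|by exists f|].
move=> x b y; rewrite /act_pred /=; split=> [<-|H].
  by rewrite -{2}[x]phi'K -[b in RHS]f'K -phiZ phiK.
by rewrite -[y]phi'K -H phiZ f'K phi'K.
Qed.

(** * The sentence *)

(** Both sorts are handled at once by working in the module M * A.  Its elements are
given by their coordinates, so that they can be transported to N * B. *)
Definition pair_comb (A : comPzRingType) (M : lmodType A) m n (g : 'I_m -> M)
    (e : 'I_n -> A) (k : 'rV[int]_m * 'rV[int]_n) : (M * A^o)%type :=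
  (comb g k.1, comb e k.2).

Fixpoint lf_span m n (gs : 'I_m -> mterm) (es : 'I_n -> aterm)
    (s : seq ('rV[int]_m * 'rV[int]_n)) (x : mterm) (b : aterm) : lformula :=
  if s is k :: r then
    lf_exA (fun a => lf_exM (fun y =>
      lf_and (lf_const (FAct (mcomb gs k.1) a y))
        (lf_span gs es r (MAdd x (MOpp y)) (asub b (AMul a (acomb es k.2))))))
  else lf_and (lf_const (FEqM x MZero)) (lf_const (FEqA b AZero)).

Definition lf_annihilator m n (gs : 'I_m -> mterm) (es : 'I_n -> aterm)
    (s : seq ('rV[int]_m * 'rV[int]_n)) (k : 'rV[int]_m * 'rV[int]_n)
    (b : aterm) : lformula :=
  lf_exM (fun y => lf_and (lf_const (FAct (mcomb gs k.1) b y))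
    (lf_span gs es s y (AMul b (acomb es k.2)))).

Section SpanFormula.
Variables (B : comPzRingType) (N : lmodType B) (m n : nat).
Variables (g : 'I_m -> N) (e : 'I_n -> B) (gs : 'I_m -> mterm) (es : 'I_n -> aterm).
Implicit Types (W : world N) (s : seq ('rV[int]_m * 'rV[int]_n)).

Lemma fden_span W s x t b a :
    (forall i, mden W (gs i) (g i)) -> (forall i, aden W (es i) (e i)) ->
    mden W t x -> aden W a b ->
  fden W (lf_span gs es s t a) (span (map (pair_comb g e) s) (x, b)).
Proof.
elim: s W x t b a => [|k s IHs] W x t b a gsg ese tx ab /=.
  apply: (fden_iff _ (fden_and (fden_eqM tx (@mden0 _ _ W))
    (fden_eqA ab (@aden0 _ _ W)))).
  by split=> [[-> ->]//|[-> ->]].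
apply: (@fden_iff _ _ _ _ (exists c, exists y, c *: comb g k.1 = y /\
  span (map (pair_comb g e) s) (x - y, b - c * comb e k.2 : B^o))).
  split=> [[c [y [<- H]]]|[c H]]; exists c; first by [].
  by exists (c *: comb g k.1).
apply: fden_exA => W1 c1 c WW1 c1c; apply: fden_exM => W2 y1 y W12 y1y.
have WW2 := extends_trans WW1 W12; have c2c := adenW W12 c1c.
have gsg2 i := mdenW WW2 (gsg i); have ese2 i := adenW WW2 (ese i).
apply: fden_and; first by apply: fden_act => //; apply: mden_comb.
apply: IHs => //.
  by apply: mdenD; [apply: mdenW tx|apply: mdenN].
apply: aden_sub; first exact: adenW ab.
by apply: adenM => //; apply: aden_comb.
Qed.

Lemma represents_annihilator W s k :
    (forall i, mden W (gs i) (g i)) -> (forall i, aden W (es i) (e i)) ->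
  represents W (lf_annihilator gs es s k)
    (annihilator (map (pair_comb g e) s) (pair_comb g e k)).
Proof.
move=> gsg ese W1 c1 c WW1 c1c.
apply: (@fden_iff _ _ _ _ (exists y, c *: comb g k.1 = y /\
  span (map (pair_comb g e) s) (y, c * comb e k.2 : B^o))).
  split=> [[y [<- H]]|H]; first exact: H.
  by exists (c *: comb g k.1).
apply: fden_exM => W2 y1 y W12 y1y.
have WW2 := extends_trans WW1 W12; have c2c := adenW W12 c1c.
have gsg2 i := mdenW WW2 (gsg i); have ese2 i := adenW WW2 (ese i).
apply: fden_and; first by apply: fden_act => //; apply: mden_comb.
by apply: fden_span => //; apply: adenM => //; apply: aden_comb.
Qed.
End SpanFormula.

(** Properties of a two-sorted module with a tuple of parameters of each sort. *)
Definition structure_property m n :=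
  forall (B : comPzRingType) (N : lmodType B), ('I_m -> N) -> ('I_n -> B) -> Prop.

Definition definable m n (Q : structure_property m n) : Prop :=
  exists F : ('I_m -> mterm) -> ('I_n -> aterm) -> lformula,
    forall (B : comPzRingType) (N : lmodType B) (W : world N) gs es g e,
      (forall i, mden W (gs i) (g i)) -> (forall i, aden W (es i) (e i)) ->
    fden W (F gs es) (Q B N g e).

Lemma definable_and m n (Q R : structure_property m n) :
  definable Q -> definable R -> definable (fun B N g e => Q B N g e /\ R B N g e).
Proof.
move=> [F FQ] [G GR]; exists (fun gs es => lf_and (F gs es) (G gs es)).
by move=> B N W gs es g e gsg ese; apply: fden_and; [apply: FQ|apply: GR].
Qed.

Lemma definable_bigand (T : eqType) m n (Q : T -> structure_property m n) (s : seq T) :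
    (forall x, definable (Q x)) ->
  definable (fun B N g e => forall x, x \in s -> Q x B N g e).
Proof.
move=> /choice[F FQ]; exists (fun gs es => lf_bigand (fun x => F x gs es) s).
by move=> B N W gs es g e gsg ese; apply: fden_bigand => x; apply: FQ.
Qed.

Lemma definable_sentence m n (Q : structure_property m n) :
    definable Q ->
  exists2 psi, is_sentence psi &
    forall (B : comPzRingType) (N : lmodType B),
      models N psi <-> exists g e, Q B N g e.
Proof.
move=> [F FQ].
(* the parameters are the variables below K, and bound variables start at K *)
pose K := maxn m n.
pose f := F (fun i => MVar i) (fun i => AVar i) K.
exists (ex_closure f) => [|B N]; first exact: ex_closure_sentence.
have fE (v : nat -> N) (w : nat -> B) :
    holds v w f <-> Q B N (fun i => v i) (fun i => w i).
  pose W := World K v w; apply: (FQ B N W _ _ _ _ _ _ W (extends_refl W)) => i.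
    by apply: (mden_var (W := W)); apply: leq_trans (ltn_ord i) (leq_maxl _ _).
  by apply: (aden_var (W := W)); apply: leq_trans (ltn_ord i) (leq_maxr _ _).
rewrite models_ex_closure; split=> [[v [w /fE]]|[g [e Qge]]]; first by eauto.
pose v i := oapp g 0 (insub i); pose w i := oapp e 0 (insub i).
exists v, w; apply/fE; move: Qge; congr Q; apply: funext => i.
  by rewrite /v valK.
by rewrite /w valK.
Qed.

(** The condition is the conjunction of those of [prime_detectable], applied along
the filtration to the annihilators, which are definable by [lf_annihilator]. *)
Lemma prime_chain_definable (A : comPzRingType) (M : lmodType A) m n
    (g : 'I_m -> M) (e : 'I_n -> A) (s : seq ('rV[int]_m * 'rV[int]_n)) :
    generates e -> prime_chain (map (pair_comb g e) s) ->
  exists Q : structure_property m n, [/\ definable Q, Q A M g e &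
    forall (B : comPzRingType) (N : lmodType B) (f : {rmorphism A -> B})
        (Phi : {additive (M * A^o)%type -> (N * B^o)%type}),
      FDZ_scalar_ring B -> (forall a x, Phi (a *: x) = f a *: Phi x) ->
      forall (g' : 'I_m -> N),
        (forall k, Phi (pair_comb g e k) = pair_comb g' (f \o e) k) ->
      Q B N g' (f \o e) -> chain_bijective f Phi (map (pair_comb g e) s)].
Proof.
move=> gen; elim: s => [_|k s IHs /= [Pk /IHs[Q [Qdef Qholds Qbij]]]].
  exists (fun B N g e => True); split=> //.
  by exists (fun _ _ => lf_const (FEqM MZero MZero)).
have [R [[chi chiR] Rholds Rdet]] :=
  prime_detectable gen (annihilator_ideal _ _) Pk.
exists (fun B N g e =>
  R B e (annihilator (map (pair_comb g e) s) (pair_comb g e k)) /\ Q B N g e).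
split=> //.
  apply: definable_and => //.
  exists (fun gs es => chi es (lf_annihilator gs es s k)).
  move=> B N W gs es g' e' gsg ese; apply: chiR => //.
  exact: represents_annihilator.
move=> B N f Phi fgB PhiZ g' PhiE [Rf Qf].
have mapE : map (pair_comb g' (f \o e)) s = map Phi (map (pair_comb g e) s).
  by rewrite -map_comp; apply: eq_map => j; rewrite /= PhiE.
rewrite -PhiE mapE in Rf.
have [|surj inj] := Rdet B f _ fgB (annihilator_ideal _ _) _ Rf.
  move=> a; rewrite /annihilator -PhiZ.
  elim: (map (pair_comb g e) s) (a *: _) => [|y r IHr] x /=.
    by move=> ->; rewrite raddf0.
  by move=> [c /IHr]; rewrite raddfB PhiZ => H; exists (f c).
by split=> //; apply: Qbij fgB PhiZ _ PhiE Qf.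
Qed.

Definition relations_hold (A : comPzRingType) (M : lmodType A) m n
    (g : 'I_m -> M) (e : 'I_n -> A) (geng : generates g) (gene : generates e)
    (Rg : seq 'rV[int]_m) (Re : seq 'rV[int]_n) : structure_property m n :=
  fun B N g' e' =>
  (forall k, k \in Rg -> comb g' k = 0) /\
  (forall k, k \in Re -> comb e' k = 0) /\
  (1 = comb e' (coord gene 1)) /\
  (forall ij : 'I_n * 'I_n, ij \in index_enum _ ->
     e' ij.1 * e' ij.2 = comb e' (coord gene (e ij.1 * e ij.2))) /\
  (forall ij : 'I_n * 'I_m, ij \in index_enum _ ->
     e' ij.1 *: g' ij.2 = comb g' (coord geng (e ij.1 *: g ij.2))).

Lemma relations_hold_definable (A : comPzRingType) (M : lmodType A) m n
    (g : 'I_m -> M) (e : 'I_n -> A) (geng : generates g) (gene : generates e) Rg Re :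
  definable (relations_hold geng gene Rg Re).
Proof.
apply: definable_and.
  apply: definable_bigand => k.
  exists (fun gs es => lf_const (FEqM (mcomb gs k) MZero)).
  by move=> B N W gs es g' e' gsg ese; apply: fden_eqM => //; apply: mden_comb.
apply: definable_and.
  apply: definable_bigand => k.
  exists (fun gs es => lf_const (FEqA (acomb es k) AZero)).
  by move=> B N W gs es g' e' gsg ese; apply: fden_eqA => //; apply: aden_comb.
apply: definable_and.
  exists (fun gs es => lf_const (FEqA AOne (acomb es (coord gene 1)))).
  by move=> B N W gs es g' e' gsg ese; apply: fden_eqA => //; apply: aden_comb.
apply: definable_and; apply: definable_bigand => -[i j] /=.
  exists (fun gs es => lf_const (FEqA (AMul (es i) (es j))
    (acomb es (coord gene (e i * e j))))).
  move=> B N W gs es g' e' gsg ese; apply: fden_eqA; last exact: aden_comb.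
  exact: adenM.
exists (fun gs es => lf_const (FAct (gs j) (es i)
  (mcomb gs (coord geng (e i *: g j))))).
by move=> B N W gs es g' e' gsg ese; apply: fden_act => //; apply: mden_comb.
Qed.

Definition spanned_by m n (s : seq ('rV[int]_m * 'rV[int]_n)) :
    structure_property m n :=
  fun B N g e => forall x : N, forall b : B, span (map (pair_comb g e) s) (x, b : B^o).

Lemma spanned_by_definable m n (s : seq ('rV[int]_m * 'rV[int]_n)) :
  definable (spanned_by s).
Proof.
exists (fun gs es => lf_allM (fun x => lf_allA (fun b => lf_span gs es s x b))).
move=> B N W gs es g e gsg ese; apply: fden_allM => W1 x1 x WW1 x1x.
apply: fden_allA => W2 b1 b W12 b1b; have WW2 := extends_trans WW1 W12.
apply: fden_span => // [i|i|]; first exact: mdenW (gsg i).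
  exact: adenW (ese i).
exact: mdenW x1x.
Qed.

Theorem theorem1p1 (A : comPzRingType) (M : lmodType A)
    (hA : FDZ_scalar_ring A) (hM : fg_module M) :
  exists psi : formula,
    is_sentence psi /\ models M psi /\
    forall (B : comPzRingType) (N : lmodType B),
      FDZ_scalar_ring B -> fg_module N ->
      (models N psi <-> module_iso N M).
Proof.
have fgM := fg_module_abelian hA hM.
have /fg_abelianP[n [e gene]] := hA; have /fg_abelianP[m [g geng]] := fgM.
have [Re ReE] := relations_fg e; have [Rg RgE] := relations_fg g.
have [s0 chain_s0 span_s0] :=
  @exists_prime_chain A (M * A^o)%type hA (fg_abelian_pair fgM hA).
pose s := [seq (coord geng x.1, coord gene x.2) | x <- s0].
have s0E : s0 = map (pair_comb g e) s.
  rewrite -map_comp -[LHS]map_id; apply: eq_map => x.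
  by rewrite /= /pair_comb !coordK; case: x.
rewrite s0E in chain_s0 span_s0.
have [Q [Qdef QM Qbij]] := prime_chain_definable gene chain_s0.
have [psi psi_sentence psiE] := definable_sentence
  (definable_and (relations_hold_definable geng gene Rg Re)
    (definable_and (spanned_by_definable s) Qdef)).
have psiM : models M psi.
  apply/psiE; exists g, e; split; last by split=> // x b; apply: span_s0.
  split=> [k kR|]; first by apply/RgE/mem_span.
  split=> [k kR|]; first by apply/ReE/mem_span.
  by rewrite !coordK; split=> //; split=> ij _; rewrite coordK.
exists psi; split=> //; split=> // B N fgB _; split=> [/psiE|iso]; last first.
  exact: models_iso iso psiM.
move=> [g' [e' [[relg [rele [one [mul act]]]] [spanN Qf]]]].
have rel_e k : comb e k = 0 -> comb e' k = 0.
  move=> /ReE; apply: (zspan_min (H := fun k => comb e' k = 0)) => //.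
  by split=> [|x y ex ey]; rewrite ?comb0 // combB ex ey subrr.
have rel_g k : comb g k = 0 -> comb g' k = 0.
  move=> /RgE; apply: (zspan_min (H := fun k => comb g' k = 0)) => //.
  by split=> [|x y ex ey]; rewrite ?comb0 // combB ex ey subrr.
have [f [phi [fe phig phiZ]]] :
    exists (f : {rmorphism A -> B}) (phi : {additive M -> N}),
    [/\ f \o e = e', phi \o g = g' & forall a x, phi (a *: x) = f a *: phi x].
  apply: (presented_morphism rel_e rel_g (gene := gene) (geng := geng)) => // i j.
    exact: mul (i, j) (mem_index_enum _).
  exact: act (i, j) (mem_index_enum _).
pose Phi (x : M * A^o) : N * B^o := (phi x.1, f x.2).
have PhiB : zmod_morphism Phi.
  by move=> x y; rewrite /Phi /= !raddfB.
pose mPhi := GRing.isZmodMorphism.Build (M * A^o)%type (N * B^o)%type Phi PhiB.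
pose aPhi : {additive (M * A^o)%type -> (N * B^o)%type} := HB.pack Phi mPhi.
have PhiZ a x : aPhi (a *: x) = f a *: aPhi x.
  by rewrite /= /Phi /= phiZ rmorphM.
have PhiE k : aPhi (pair_comb g e k) = pair_comb g' (f \o e) k.
  by rewrite /= /Phi /pair_comb /= !raddf_comb phig.
rewrite -fe in Qf spanN.
have bij := Qbij B N f aPhi fgB PhiZ g' PhiE Qf.
have [Psi PhiK PsiK] : bijective aPhi.
  apply: (chain_bijectiveP PhiZ span_s0 _ bij) => -[x b].
  rewrite -map_comp (eq_map (g := pair_comb g' (f \o e))) //.
have PhiI := can_inj PhiK.
apply: (module_iso_inv (f := f) (phi := phi)) => //.
  apply: inj_surj_bijective => [a b fab|b].
    by have /PhiI[] : aPhi (0, a) = aPhi (0, b) by rewrite /= /Phi /= fab.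
  by exists (Psi (0, b)).2; have /= := PsiK (0, b); case.
apply: inj_surj_bijective => [x y xy|y].
  by have /PhiI[] : aPhi (x, 0) = aPhi (y, 0) by rewrite /= /Phi /= xy.
by exists (Psi (y, 0)).1; have /= := PsiK (y, 0); case.
Qed.
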